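(* Let $C:f=0$ be a reduced curve of degree $d\ge 3$ in $\mathbb{P}^2$, let $f=f_1\cdots f_s$ be the factorization of $f$ into irreducible factors, and let $C_i:f_i=0$ be the irreducible components of $C$. Assume that $s>1$ and that $C_s$ is a smooth curve of degree $d_s$. Set $f'=f_1\cdots f_{s-1}$ and $C'=C_1\cup\dots\cup C_{s-1}:f'=0$. Then $$\operatorname{reg}(D_0(f))\le \max\left(\operatorname{reg}(D_0(f'))+d_s,\ \deg(C')+2d_s-3\right).$$
   Context: Let $S=\mathbb{C}[x,y,z]$ with its standard grading and $\mathbb{P}^2$ the complex projective plane. For a homogeneous polynomial $h\in S$ with partial derivatives $h_x,h_y,h_z$, put $$D_0(h)=\{(a,b,c)\in S^3 : ah_x+bh_y+ch_z=0\},$$ a graded $S$-module, where $(a,b,c)$ with $a,b,c$ homogeneous of degree $k$ has degree $k$. Regularity: for a graded $S$-module $M$ with associated coherent sheaf $\widetilde M$ on $\mathbb{P}^2$, $\widetilde M$ is called $m$-regular if $H^1(\mathbb{P}^2,\widetilde M(m-1))=H^2(\mathbb{P}^2,\widetilde M(m-2))=0$. The minimal $m$ such that $\widetilde M$ is $m$-regular is the Castelnuovo-Mumford regularity $\operatorname{reg}\widetilde M$, and $\operatorname{reg} M:=\operatorname{reg}\widetilde M$. *)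

(* Defs.v *)
From mathcomp Require Import all_boot all_order all_algebra.
From mathcomp Require Import mpoly complex.
From mathcomp Require Import boolp classical_sets reals constructive_ereal ereal.

Set Implicit Arguments.
Unset Strict Implicit.
Unset Printing Implicit Defensive.

Import Order.TTheory GRing.Theory Num.Theory.

Local Open Scope ring_scope.
Local Open Scope classical_set_scope.

(** The ring S = C[x,y,z], with C = R[i]; the variables are 'X_0, 'X_1, 'X_2. *)
Notation polyS R := {mpoly R[i][3]}.

Definition irreducible_elt (A : idomainType) (p : A) : Prop :=
  [/\ p != 0, p \isn't a GRing.unit &
      forall a b : A, p = a * b -> a \is a GRing.unit \/ b \is a GRing.unit].

(** The curve h = 0 is reduced iff h has no multiple factor. *)
Definition squarefree_elt (A : idomainType) (h : A) : Prop :=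
  h != 0 /\ forall g q : A, h = q * g ^+ 2 -> g \is a GRing.unit.

Section CechRegularity.
Variable R : realType.
Local Notation S := (polyS R).

(** [msize] is one more than the total degree of a nonzero polynomial. *)
Definition tdegree (p : S) : nat := (msize p).-1.

Definition smooth_curve (g : S) : Prop :=
  forall P : 'I_3 -> R[i], (exists i, P i != 0) -> g.@[P] = 0 ->
    exists i, (g^`M(i)).@[P] != 0.

(** Triples (a, b, c) are row vectors. *)
Definition D0 (h : S) : set 'rV[S]_3 :=
  [set v | \sum_(i < 3) v 0 i * h^`M(i) = 0].

Definition monJ (J : {set 'I_3}) : S := \prod_(i in J) 'X_i.

(** A graded submodule M of S^r is given by its underlying set. Since M is
    torsion-free, its localization at a monomial x_J is the subset of
    Frac(S)^r of the fractions v / x_J^m with v in M. For J nonempty, [loc M J k]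
    is the degree k part of that localization, i.e. the group of sections of
    M~(k) over the open set D_+(x_J) of P^2. *)
Definition loc (r : nat) (M : set 'rV[S]_r) (J : {set 'I_3}) (k : int) :
    set 'rV[{fraction S}]_r :=
  [set w | exists (m e : nat) (v : 'rV[S]_r),
    [/\ M v, forall j, v 0 j \is e.-homog, e%:Z = k + (m * #|J|)%N%:Z &
        w = (tofrac (monJ J ^+ m))^-1 *: map_mx (@tofrac S) v]].

(** Alternating Cech cochains for the cover of P^2 by the D_+(x_i): a
    p-cochain is indexed by the subsets J with p + 1 elements, and its other
    values are irrelevant. *)
Definition cochain (r : nat) (M : set 'rV[S]_r) (k : int) (p : nat)
    (c : {set 'I_3} -> 'rV[{fraction S}]_r) : Prop :=
  forall J : {set 'I_3}, #|J| = p.+1 -> loc M J k (c J).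

Definition cech_diff (r : nat) (c : {set 'I_3} -> 'rV[{fraction S}]_r)
    (J : {set 'I_3}) : 'rV[{fraction S}]_r :=
  \sum_(j in J) (-1) ^+ #|[set i in J | (i < j)%N]| *: c (J :\ j).

(** [cech_acyclic M k q] : H^(q+1)(P^2, M~(k)) = 0. *)
Definition cech_acyclic (r : nat) (M : set 'rV[S]_r) (k : int) (q : nat) : Prop :=
  forall c, cochain M k q.+1 c ->
    (forall J : {set 'I_3}, #|J| = q.+3 -> cech_diff c J = 0) ->
    exists2 b, cochain M k q b &
      forall J : {set 'I_3}, #|J| = q.+2 -> c J = cech_diff b J.

(** m-regularity: H^1(P^2, M~(m-1)) = H^2(P^2, M~(m-2)) = 0. *)
Definition regular (r : nat) (M : set 'rV[S]_r) (m : int) : Prop :=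
  cech_acyclic M (m - 1) 0 /\ cech_acyclic M (m - 2) 1.

(** The minimal m such that M~ is m-regular. It is taken in the extended line,
    with the usual conventions: -oo if there are arbitrarily small such m, and
    +oo if there is none. *)
Definition reg (r : nat) (M : set 'rV[S]_r) : \bar R :=
  ereal_inf [set (m%:~R)%:E | m in regular M].

End CechRegularity.

(* Main.v *)
(* Write [f = f' g] with [g] the equation of degree [e] of the smooth component
   and [E] for the Euler derivation. Multiplication by [g], corrected by a
   multiple of [E], embeds [D_0(f')(-e)] into [D_0(f)], and the quotient sheaf
   lives on the curve [g = 0]. The Koszul derivations [grad f x rho] land in it
   through the restriction of [rho.E] to the curve only, which gives a copy of
   [O_C(2 - e - deg f')]; since [g] is smooth, [f'] and [g] kill what is left, so
   the latter is supported at the finitely many points of [f' = g = 0] and has no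
   [H^1]. As [H^1(O_C(j)) = 0] for [j >= e - 2], the bounds on [H^1] and [H^2] of
   [D_0(f)] follow from those of [D_0(f')] (which propagate upwards, by
   Castelnuovo-Mumford). Coprimality of [f'] and [g] is used in the form of a
   Bezout identity, in each affine chart, with right hand side a nonzero
   polynomial in one coordinate; smoothness through the Nullstellensatz, which
   inverts [grad g] on each chart. *)
From HB Require Import structures.
Require Import Defs.
From mathcomp Require Import all_boot all_order all_algebra.
From mathcomp Require Import mpoly complex ring zify.
From mathcomp Require Import boolp classical_sets reals constructive_ereal ereal.
(* Again, as [classical_sets] hides some of their names. *)
From mathcomp Require Import fintype finset.

Set Implicit Arguments.
Unset Strict Implicit.
Unset Printing Implicit Defensive.

Import Order.TTheory GRing.Theory Num.Theory.

Local Open Scope ring_scope.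

(** * Polynomials in two variables *)

(** Origin of the constant: in degree k the copy of O_C is O_C(k + 2 - e - deg f'), and k + 2 - e -
    deg f' >= e - 2 for k = m - 1 reads m >= deg f' + 2e - 3. No quotient sheaf is formed. All
    sections live in Frac(S)^3, an equality in the quotient is witnessed by an explicit pair (rho,
    w), and each long exact sequence becomes a chase of cochains on the three standard charts. The
    vanishing of H^1 for the part with finite support is replaced by functions that behave like
    idempotents modulo (f', g): they extend a section from a smaller open set to a larger one, up to
    witnessed terms. *)

Lemma ord3P (l : 'I_3) : [\/ l = 0, l = 1 | l = 2].
Proof.
by case: l => [[|[|[|l]]] h] //; [apply: Or31|apply: Or32|apply: Or33];
  apply: val_inj.
Qed.

Lemma sum3E (V : nmodType) (F : 'I_3 -> V) : \sum_l F l = F 0 + F 1 + F 2.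
Proof.
rewrite !big_ord_recl big_ord0 addr0 addrA.
by congr (_ + F _ + F _); apply: val_inj.
Qed.

Section Bivariate.
Variable K : closedFieldType.
Local Notation A := {poly K}.
Local Notation B := {poly {poly K}}.

Definition specialize (c : K) : B -> A := map_poly (horner_eval c).
HB.instance Definition _ (c : K) :=
  GRing.RMorphism.copy (specialize c) (map_poly (horner_eval c)).

Lemma specC (c : K) (a : A) : specialize c a%:P = a.[c]%:P.
Proof. by rewrite /specialize map_polyC. Qed.

Lemma specM (c : K) : {morph specialize c : U V / U * V}.
Proof. exact: rmorphM. Qed.

Lemma spec_eq0 (c : K) (U : B) :
  specialize c U = 0 -> exists V, U = ('X - c%:P)%:P * V.
Proof.
move=> h; exists (\poly_(i < size U) (U`_i %/ ('X - c%:P))).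
apply/polyP=> i; rewrite coefCM coef_poly.
have [_|hi] := ltnP; last by rewrite nth_default // mulr0.
have /polyP /(_ i) := h; rewrite coef_map coef0 /= => /eqP.
by rewrite -[_ == 0]/(root _ _) -dvdp_XsubCl => /divpK {1}<-; rewrite mulrC.
Qed.

(** Over a closed field [p] splits into linear factors, which are moved into [S] one at a time: at a
    root [c] the left side specializes to 0 while [specialize c P] does not, so [X - c] divides
    [S]. *)
Lemma primitive_dvd (p : A) (P S S' : B) :
    p != 0 -> (forall c, specialize c P != 0) -> p%:P * S' = P * S ->
  exists W, S = p%:P * W.
Proof.
move=> p0 hP; have [r pE] := closed_field_poly_normal p.
have lc0 : lead_coef p != 0 by rewrite lead_coef_eq0.
rewrite pE => {pE}; elim: r S => [|c r IH] S.
  move=> _; exists ((lead_coef p)^-1%:P%:P * S).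
  by rewrite big_nil alg_polyC mulrA -!polyCM mulfV // mul1r.
rewrite big_cons scalerAr polyCM -mulrA => h.
have : specialize c (P * S) = 0.
  by rewrite -h !specM specC hornerXsubC subrr polyC0 mul0r.
rewrite specM => /eqP; rewrite mulf_eq0 (negPf (hP c)) /= => /eqP.
case/spec_eq0 => V SE; rewrite SE in h *.
have [W ->] : exists W, V = (lead_coef p *: \prod_(j <- r) ('X - j%:P))%:P * W.
  apply: IH; apply: (@mulfI _ ('X - c%:P)%:P); last by rewrite h; ring.
  by rewrite polyC_eq0 polyXsubC_eq0.
by exists W; rewrite mulrA.
Qed.

Lemma primitive_part (D : B) : D != 0 ->
  exists (a : A) (D' : B), [/\ a != 0, D = a%:P * D' & forall c,
    specialize c D' != 0].
Proof.
(* Pulling [X - c] out of all coefficients lowers the degree of the leading one, so the extraction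
   stops. *)
have [n] := ubnP (size (lead_coef D)); elim: n D => // n IH D hn D0.
have [hD|[c /eqP hc]] : (forall c, specialize c D != 0) \/ exists c,
  specialize c D == 0.
  case: (pselect (exists c, specialize c D == 0)) => h; [by right|left=> c].
  by apply/negP=> hc; apply: h; exists c.
- by exists 1, D; rewrite mul1r oner_neq0.
have [V DE] := spec_eq0 hc; have V0 : V != 0.
  by apply: contraNneq D0 => V0; rewrite DE V0 mulr0.
have [|a [D' [a0 VE hD']]] := IH V _ V0.
  move: hn; rewrite DE lead_coefM lead_coefC mulrC.
  by rewrite size_Mmonic ?monicXsubC ?lead_coef_eq0 // size_XsubC addn2.
exists (('X - c%:P) * a), D'; split=> //.
- by rewrite mulf_neq0 ?polyXsubC_eq0.
- by rewrite DE VE polyCM mulrA.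
Qed.

(* Gauss's lemma: a common factor over the fraction field of [A] can be taken
   primitive, and then it is a common factor over [A]. *)
Lemma coprime_bezout (F G : B) : F != 0 ->
    (forall D U V, F = D * U -> G = D * V -> (size D <= 1)%N) ->
  exists (p : A) (a b : B), p != 0 /\ p%:P = a * F + b * G.
Proof.
move=> F0 hFG; have [hD|hD] := leqP (size (gcdp F G)) 1.
  have /Pdiv.Idomain.Bezout_coprimepP [[a b] /eqpP[[c1 c2] /= /andP[c10 c20] h]]
    : coprimep F G.
    by rewrite /coprimep eqn_leq hD size_poly_gt0 gcdp_eq0 (negPf F0).
  exists c2, (c1%:P * a), (c1%:P * b); split => //.
  by rewrite -!mulrA -mulrDr mul_polyC h alg_polyC.
(* Otherwise the primitive part [D] of the gcd divides [F] and [G] over [A] itself and has the size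
   of the gcd, against the hypothesis. *)
have D0 : gcdp F G != 0 by rewrite -size_poly_gt0 ltnW.
have [a [D [a0 DE hprim]]] := primitive_part D0.
have dvdD H : gcdp F G %| H -> exists U, H = D * U.
  case/Pdiv.Idomain.dvdpP=> -[c q] /= c0; rewrite -mul_polyC DE => h.
  have [|W qE] := @primitive_dvd c D (q * a%:P) H c0 hprim; first by rewrite h; ring.
  exists W; apply: (@mulfI _ c%:P); first by rewrite polyC_eq0.
  by rewrite h mulrA qE; ring.
have [U FE] := dvdD F (dvdp_gcdl _ _); have [V GE] := dvdD G (dvdp_gcdr _ _).
by have := hFG _ _ _ FE GE; rewrite leqNgt -(size_Cmul D a0) -DE hD.
Qed.

Lemma bezout3 (g : 'I_3 -> {poly K}) :
    (forall z, exists l, (g l).[z] != 0) ->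
  exists a, \sum_l a l * g l = 1.
Proof.
move=> hg; pose D := gcdp (gcdp (g 0) (g 1)) (g 2).
have D1 : coprimep (gcdp (g 0) (g 1)) (g 2).
  rewrite /coprimep; apply/negPn/negP => /closed_rootP[z].
  rewrite !root_gcd => /andP[/andP[h0 h1] h2].
  by have [l] := hg z; rewrite -rootE; case: (ord3P l) => ->; rewrite ?h0 ?h1 ?h2.
have /Bezout_eq1_coprimepP[[u v] /= uv] := D1.
have [[s t] /= /eqpP[[c1 c2] /= /andP[c10 c20] st]] := Bezoutp (g 0) (g 1).
pose c := c2^-1 * c1.
have gE : gcdp (g 0) (g 1) = c *: (s * g 0 + t * g 1).
  by rewrite -scalerA st scalerA mulVf // scale1r.
exists (fun l : 'I_3 => if l == 0 then u * (c *: s) else if l == 1 then u * (c *: t)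
  else v).
by rewrite sum3E /= -uv gE -!mul_polyC; ring.
Qed.

(** By elimination: the ideal contains some nonzero [p] in the inner variable alone, and it contains
    1 modulo each [X - c] (one-variable Bezout on that fibre), so the linear factors of [p] can be
    removed one by one. *)
Lemma nullstellensatz2 (g : 'I_3 -> B) :
    (forall y z : K, exists l, (specialize y (g l)).[z] != 0) ->
  exists a, \sum_l a l * g l = 1.
Proof.
move=> hg.
have hc c : exists a h, 1 = \sum_l a l * g l + ('X - c%:P)%:P * h.
  have [|a ha] := @bezout3 (fun l => specialize c (g l)); first by move=> z;
    exact: hg.
  have [|h hE] := @spec_eq0 c (1 - \sum_l (map_poly polyC (a l)) * g l).
    rewrite rmorphB rmorph1 rmorph_sum -[1 in LHS]ha -sumrB big1 // => l _.
    rewrite /= specM /specialize -map_poly_comp map_poly_id ?subrr // => x _ /=.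
    by rewrite /horner_eval hornerC.
  by exists (fun l => map_poly polyC (a l)), h; rewrite -hE addrC subrK.
suff [p [a [p0 ha]]] : exists (p : A) a, p != 0 /\ p%:P = \sum_l a l * g l.
  have [r pE] := closed_field_poly_normal p.
  have {p a p0 ha pE}[a ha] : exists a,
    (\prod_(j <- r) ('X - j%:P))%:P = \sum_l a l * g l.
    exists (fun l => (lead_coef p)^-1%:P%:P * a l).
    rewrite (eq_bigr _ (fun l _ => esym (mulrA _ _ _))) -mulr_sumr -ha {2}pE
      -mul_polyC.
    by rewrite -polyCM mulrA -polyCM mulVf ?lead_coef_eq0 // polyC1 mul1r.
  elim: r a ha => [|c r IH] a.
    by rewrite big_nil polyC1 => ha; exists a.
  rewrite big_cons => ha; have [b [h hb]] := hc c.
  apply: (IH (fun l => (\prod_(j <- r) ('X - j%:P))%:P * b l + h * a l)).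
  rewrite -[LHS]mulr1 hb mulrDr mulr_sumr mulrA (mulrC _%:P) -polyCM ha mulrC.
  by rewrite mulr_sumr -big_split; apply: eq_bigr => l _ /=; ring.
pose D1 := gcdp (g 0) (g 1); pose D := gcdp D1 (g 2).
(* A common factor of positive degree gives a common zero: [y] avoids the roots of the leading
   coefficient of [D] and of the pseudo-division constants, so [D] keeps its degree at [y], and a
   root [z] there kills every [g l]. *)
have [hD|hD] := leqP (size D) 1; last first.
  have dv l : D %| g l.
    case: (ord3P l) => ->; last exact: dvdp_gcdr.
      exact: dvdp_trans (dvdp_gcdl _ _) (dvdp_gcdl _ _).
    exact: dvdp_trans (dvdp_gcdl _ _) (dvdp_gcdr _ _).
  have hk l : exists cq : A * B, (cq.1 != 0) && (cq.1 *: g l == cq.2 * D).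
    have /Pdiv.Idomain.dvdpP[cq c0 e] := dv l.
    by exists cq; rewrite c0 e eqxx.
  pose cq l := xchoose (hk l).
  have q0 : lead_coef D * \prod_l (cq l).1 != 0.
    apply: mulf_neq0; first by rewrite lead_coef_eq0 -size_poly_gt0 ltnW.
    by apply/prodf_neq0 => l _; have /andP[] := xchooseP (hk l).
  have [y] := @closed_nonrootP _ _ q0.
  rewrite rootE hornerM horner_prod mulf_eq0 negb_or => /andP[y1 /prodf_neq0 y2].
  have sD : size (specialize y D) = size D by apply: size_map_poly_id0.
  have /closed_rootP[z /eqP hz]
    : size (specialize y D) != 1 by rewrite sD neq_ltn hD orbT.
  have [l /negP[]] := hg y z.
  have /andP[_ /eqP /(congr1 (fun q => (specialize y q).[z]))] := xchooseP (hk l).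
  rewrite -mul_polyC !specM specC !hornerM hornerC hz mulr0 => /eqP.
  by rewrite mulf_eq0 (negPf (y2 l isT)).
have D_0 : D != 0.
  apply/negP=> /eqP/eqP; rewrite !gcdp_eq0 => /andP[/andP[/eqP h0 /eqP h1] /eqP h2].
  have [l /negP[]] := hg 0 0.
  by case: (ord3P l) => ->; rewrite ?h0 ?h1 ?h2 /specialize map_poly0 horner0.
have [[s t] /= /eqpP[[c1 c2] /= /andP[c10 c20] st]]
  := Pdiv.Idomain.Bezoutp (g 0) (g 1).
have /Pdiv.Idomain.Bezout_coprimepP [[u v] /eqpP[[e1 e2] /= /andP[e10 e20] uv]]
  : coprimep D1 (g 2).
  by rewrite /coprimep eqn_leq hD size_poly_gt0.
exists (c2 * e2), (fun l : 'I_3 => if l == 0 then (c1 * e1)%:P * u * s else if l == 1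
  then (c1 * e1)%:P * u * t else (c2 * e1)%:P * v).
split; first exact: mulf_neq0.
rewrite sum3E /=; move: st uv; rewrite -!mul_polyC mulr1 !polyCM => st <-.
have -> : c2%:P * (e1%:P * (u * D1 + v * g 2)) = e1%:P * u * (c2%:P * D1) + e1%:P *
  c2%:P * v * g 2 by ring.
by rewrite -st; ring.
Qed.
End Bivariate.

(** * Homogeneous polynomials *)

Section Homogeneous.
Variables (K : fieldType) (n : nat).
Local Notation S := {mpoly K[n]}.

Lemma homog_ind (P : S -> Prop) (e : nat) : P 0 ->
    (forall p q, P p -> P q -> P (p + q)) ->
    (forall c m, mdeg m = e -> P (c *: 'X_[m])) ->
  forall v : S, v \is e.-homog -> P v.
Proof.
move=> P0 PD PX v /dhomogP hv; rewrite (mpolyE v) big_seq.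
by apply: big_ind => // m /hv; exact: PX.
Qed.

Lemma mderiv_homog (e : nat) (v : S) (i : 'I_n) :
  v \is e.+1.-homog -> v^`M(i) \is e.-homog.
Proof.
move: v; apply: homog_ind => [|p q hp hq|c m hm].
- by rewrite mderiv0 dhomog0.
- by rewrite mderivD dhomogD.
rewrite mderivZ mderivX dhomogZ //.
have [->|mi] := eqVneq (m i) 0%N; first by rewrite scale0r dhomog0.
have hd : mdeg (m - U_(i)) = e.
  have hm' : (m - U_(i) + U_(i))%MM = m by rewrite submK // lep1mP.
  by apply/eqP; rewrite -eqSS -hm -{2}hm' mdegD mdeg1 addn1.
by rewrite dhomogZ // dhomogX; apply/eqP.
Qed.

Lemma euler (e : nat) (v : S) : v \is e.-homog ->
  \sum_i 'X_i * v^`M(i) = e%:R *: v.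
Proof.
move: v; apply: homog_ind => [|p q hp hq|c m hm].
- by rewrite big1 ?scaler0 // => i _; rewrite mderiv0 mulr0.
- rewrite scalerDr -hp -hq -big_split; apply: eq_bigr => i _.
  by rewrite mderivD mulrDr.
rewrite -hm mdegE natr_sum scaler_suml; apply: eq_bigr => i _.
rewrite mderivZ mderivX -!scalerAr scalerA.
have [->|mi] := eqVneq (m i) 0%N; first by rewrite mulr0 !scale0r.
by rewrite -mpolyXD addmC submK ?lep1mP // scalerA mulrC.
Qed.

Lemma homog0E (v : S) : v \is 0.-homog -> v = (v@_0%MM)%:MP.
Proof.
move: v; apply: homog_ind => [|p q hp hq|c m /eqP].
- by rewrite mcoeff0 mpolyC0.
- by rewrite mcoeffD mpolyCD -hp -hq.
by rewrite mdeg_eq0 => /eqP->; rewrite mpolyX0 alg_mpolyC mcoeffC eqxx mulr1.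
Qed.

(** Evaluation at 0 shows that [X] divides [P] or [Q]; it is cancelled until [d] is 0, where only
    constants remain. *)
Lemma prod_monomialP (D : idomainType) (d : nat) (c : D) (P Q : {poly D}) :
  c != 0 -> P * Q = c *: 'X^d -> exists e a, P = a *: 'X^e.
Proof.
elim: d P Q => [|d IH] P Q c0 h.
  have := congr1 (fun p : {poly D} => size p) h.
  have PQ0 : P * Q != 0 by rewrite h alg_polyC polyC_eq0.
  move: (PQ0); rewrite mulf_eq0 negb_or => /andP[P0 Q0].
  rewrite size_mul // alg_polyC size_polyC c0 => hs.
  have /size1_polyC PE : (size P <= 1)%N.
    by move: hs P0 Q0; rewrite -!size_poly_gt0; lia.
  by exists 0%N, P`_0; rewrite alg_polyC.
have divX (p : {poly D}) : p.[0] = 0 -> exists p', p = p' * 'X.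
  by move=> /eqP/factor_theorem [p']; rewrite subr0; exists p'.
have := congr1 (fun p => p.[0]) h.
rewrite hornerM hornerZ hornerXn expr0n mulr0 => /eqP.
rewrite mulf_eq0 => /orP[] /eqP /divX [R RE]; rewrite RE in h *.
  have [|e [a ->]] := IH R Q c0; last by exists e.+1, a; rewrite exprSr scalerAl.
  by apply: (@mulIf _ 'X); rewrite ?polyX_eq0 // mulrAC h exprSr scalerAl.
apply: (IH P R c0); apply: (@mulIf _ 'X); rewrite ?polyX_eq0 //.
by rewrite -mulrA h exprSr scalerAl.
Qed.

(* The substitution [x -> t x] turns being homogeneous into being a monomial
   in [t]. *)
Definition grading : S -> {poly S} :=
  mmap (polyC \o @mpolyC n K) (fun i => ('X_i)%:P * 'X).

Lemma gradingX m : grading 'X_[m] = 'X_[m] *: 'X^(mdeg m).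
Proof.
rewrite /grading mmapX /mmap1 mpolyXE_id mdegE -prodrXr -mul_polyC rmorph_prod
  -big_split.
by apply: eq_bigr => i _; rewrite exprMn rmorphXn.
Qed.

Lemma grading_coef (v : S) k : (grading v)`_k = pihomog mdeg k v.
Proof.
elim/mpolyind: v => [|c m p _ _ IH]; first by rewrite /grading mmap0 coef0 pihomog0.
rewrite {1}/grading mmapD mmapZ coefD -/grading IH linearD linearZ /= pihomogX.
rewrite -/grading gradingX coefCM coefZ coefXn; congr (_ + _).
by rewrite eq_sym; case: eqP; rewrite ?mulr1 ?mul_mpolyC ?mulr0 ?scaler0.
Qed.

(** Only the product of the components is given as homogeneous; this is what provides degrees for
    [f'] and for the smooth component. [grading] is multiplicative, so it sends a factor to a factor
    of a monomial in [t]. *)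
Lemma homog_factor (d : nat) (p q : S) :
  p * q != 0 -> p * q \is d.-homog -> exists e, p \is e.-homog.
Proof.
move=> pq0 hpq; have [e [a pE]] : exists e a, grading p = a *: 'X^e.
  apply: (@prod_monomialP _ d (p * q) _ (grading q)) => //.
  rewrite -[LHS](rmorphM (mmap (polyC \o @mpolyC n K) (fun i => ('X_i)%:P * 'X))).
  apply/polyP=> k; rewrite grading_coef coefZ coefXn.
  have [->|kd] := eqVneq k d; first by rewrite mulr1 pihomog_dE.
  by rewrite mulr0 (pihomog_ne0 _ hpq) // eq_sym.
exists e; rewrite (pihomog_partitionE (leqnn (msize p))).
apply: rpred_sum => k _; have [<-|ke] := eqVneq (k : nat) e; first exact: pihomogP.
by rewrite -grading_coef pE coefZ coefXn (negPf ke) mulr0 dhomog0.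
Qed.
End Homogeneous.

(** * Graded localizations *)

Section Localization.
Variable K : fieldType.
Local Notation S := {mpoly K[3]}.
(* [T] stands for the fraction field of [S]: it is abstract because [field]
   diverges on the concrete one. *)
Variables (T : fieldType) (tf : {rmorphism S -> T}).
Hypothesis tf_inj : injective tf.
Implicit Types (J : {set 'I_3}) (k l : int) (s t : T).

Definition mon J : S := \prod_(i in J) 'X_i.
Definition frac_var (i : 'I_3) : T := tf 'X_i.
Local Notation X := frac_var.

Definition locpart J k t : Prop := exists (m e : nat) (v : S),
  [/\ v \is e.-homog, e%:Z = k + (m * #|J|)%N%:Z &
      t = (tf (mon J ^+ m))^-1 * tf v].

Lemma tf_eq0 v : (tf v == 0) = (v == 0).
Proof. by rewrite -(rmorph0 tf) (inj_eq tf_inj). Qed.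

Lemma Xvar_neq0 (i : 'I_3) : 'X_i != 0 :> S.
Proof. by rewrite -msize_poly_eq0 msizeX. Qed.

Lemma mon_neq0 J : mon J != 0.
Proof. by apply/prodf_neq0 => i _; exact: Xvar_neq0. Qed.

Lemma tf_mon_neq0 J m : tf (mon J ^+ m) != 0.
Proof. by rewrite tf_eq0 expf_neq0 ?mon_neq0. Qed.

Lemma frac_var_neq0 i : X i != 0.
Proof. by rewrite tf_eq0 Xvar_neq0. Qed.

Lemma mon_homog J : mon J \is #|J|.-homog.
Proof.
rewrite /mon -sum1_card.
elim/big_rec2: _ => [|i e p _ hp]; first exact: dhomog1.
by rewrite dhomogM // dhomogX; apply/eqP; exact: mdeg1.
Qed.

Lemma monD J J' : J \subset J' -> mon J' = mon J * mon (J' :\: J).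
Proof.
by move=> hJ; rewrite /mon [LHS](big_setID J) (setIidPr hJ).
Qed.

Lemma mon1 i : mon [set i] = 'X_i.
Proof. by rewrite /mon big_set1. Qed.

(** All large exponents are available, so that several fractions can be put over one denominator. *)
Lemma locpart_raise J k t : locpart J k t -> exists m0, forall m, (m0 <= m)%N ->
  exists e v, [/\ v \is e.-homog, e%:Z = k + (m * #|J|)%N%:Z &
      t = (tf (mon J ^+ m))^-1 * tf v].
Proof.
case=> m0 [e [v [hv he ->]]]; exists m0 => m hm.
exists (#|J| * (m - m0) + e)%N, (mon J ^+ (m - m0) * v); split.
- by rewrite dhomogM // dhomogMn // mon_homog.
- by move: he; rewrite -{2}(subnK hm) mulnDl; lia.
- by rewrite -{1}(subnK hm) exprD !rmorphM; field; rewrite !tf_mon_neq0.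
Qed.

Lemma locpart_homog J (e : nat) (v : S) : v \is e.-homog -> locpart J e (tf v).
Proof.
by move=> hv; exists 0%N, e, v; rewrite mul0n addr0 expr0 rmorph1 invr1 mul1r.
Qed.

Lemma locpartD J k s t : locpart J k s -> locpart J k t -> locpart J k (s + t).
Proof.
move=> /locpart_raise[m0 h0] /locpart_raise[m1 h1].
have [e [v [hv he ->]]] := h0 _ (leq_maxl m0 m1).
have [e' [v' [hv' he' ->]]] := h1 _ (leq_maxr m0 m1).
have ee : e' = e by lia.
exists (maxn m0 m1), e, (v + v'); split=> //; last by rewrite rmorphD mulrDr.
by rewrite dhomogD // -ee.
Qed.

Lemma locpart0 J k : (#|J| > 0)%N -> locpart J k 0.
Proof.
(* For negative [k] the numerator has a natural degree only over a denominator of degree at least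
   [|k|], which a nonempty [J] provides. *)
move=> hJ; exists (absz k), (absz (k + (absz k * #|J|)%N%:Z)), 0.
by rewrite dhomog0 rmorph0 mulr0; split=> //; nia.
Qed.

Lemma locpartM J k l s t :
  locpart J k s -> locpart J l t -> locpart J (k + l) (s * t).
Proof.
move=> [m [e [v [hv he ->]]]] [m' [e' [v' [hv' he' ->]]]].
exists (m + m')%N, (e + e')%N, (v * v'); split; first exact: dhomogM.
- by rewrite mulnDl; lia.
- by rewrite exprD !rmorphM; field; rewrite !tf_mon_neq0.
Qed.

Lemma locpartC J (c : K) : locpart J 0 (tf c%:MP).
Proof. by apply: (@locpart_homog _ 0); rewrite -alg_mpolyC dhomogZ // dhomog1. Qed.

Lemma locpartN J k t : locpart J k t -> locpart J k (- t).
Proof.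
move=> [m [e [v [hv he ->]]]]; exists m, e, (- v).
by rewrite dhomogN rmorphN mulrN.
Qed.

Lemma locpartB J k s t : locpart J k s -> locpart J k t -> locpart J k (s - t).
Proof. by move=> hs /locpartN; exact: locpartD. Qed.

Lemma locpart_sub J J' k t : J \subset J' -> locpart J k t -> locpart J' k t.
Proof.
move=> hJ [m [e [v [hv he ->]]]].
exists m, (#|J' :\: J| * m + e)%N, (mon (J' :\: J) ^+ m * v); split.
- by rewrite dhomogM // dhomogMn // mon_homog.
- by rewrite -(cardsID J J') (setIidPr hJ) mulnDr; lia.
- rewrite (monD hJ) exprMn !rmorphM; field.
  by rewrite !tf_mon_neq0.
Qed.

Lemma locpartX J i : locpart J 1 (X i).
Proof. by apply: (@locpart_homog _ 1); rewrite dhomogX; apply/eqP; exact: mdeg1. Qed.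

Lemma locpartXV J i : i \in J -> locpart J (-1) (X i)^-1.
Proof.
move=> iJ; exists 1%N, #|J :\ i|, (mon (J :\ i)); split.
- exact: mon_homog.
- by rewrite (cardsD1 i J) iJ; lia.
- rewrite expr1 (monD (J := [set i])) ?sub1set // mon1 rmorphM.
  by field; rewrite frac_var_neq0 -[mon _]expr1 tf_mon_neq0.
Qed.

Lemma locpartXn J k t n : locpart J k t -> locpart J (k * n%:Z) (t ^+ n).
Proof.
move=> ht; elim: n => [|n IH].
  by rewrite expr0 mulr0 -(rmorph1 tf) -mpolyC1; exact: locpartC.
by rewrite exprS intS mulrDr mulr1; exact: locpartM.
Qed.

Lemma Xn_homog (i : 'I_3) n : 'X_i ^+ n \is [in K[3], n.-homog].
Proof.
rewrite -{2}[n]mul1n; apply: dhomogMn.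
by rewrite dhomogX; apply/eqP; exact: mdeg1.
Qed.

Lemma locpart_monV J m : locpart J (- (m * #|J|)%N%:Z) (tf (mon J ^+ m))^-1.
Proof.
by exists m, 0%N, 1; rewrite dhomog1 rmorph1 mulr1; split=> //; lia.
Qed.

(** A high power of x_j clears the pole along x_j = 0, so the product extends from D_+(x_j x_J) to
    D_+(x_J). *)
Lemma locpart_clear J k j t : locpart (j |: J) k t ->
  exists m0, forall m, (m0 <= m)%N -> locpart J (k + m%:Z) (X j ^+ m * t).
Proof.
have [jJ|jJ] := boolP (j \in J).
  rewrite (setUidPr _) ?sub1set // => ht; exists 0%N => m _.
  by rewrite addrC; apply: locpartM => //; rewrite -[m%:Z]mul1r;
    exact/locpartXn/locpartX.
case=> m0 [e [v [hv he ->]]]; exists m0 => m hm.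
exists m0, (e + (m - m0))%N, (v * 'X_j ^+ (m - m0)); split.
- by rewrite dhomogM // Xn_homog.
- by move: he; rewrite cardsU1 jJ; lia.
rewrite (monD (J := [set j])) ?sub1set ?setU11 // mon1 setU1K //.
rewrite exprMn -{1}(subnK hm) exprD !rmorphM !rmorphXn -/(X j); field.
by rewrite !expf_neq0 ?frac_var_neq0 ?tf_eq0 ?mon_neq0.
Qed.
End Localization.

(** * Cohomology of the structure sheaf *)

Section StructureSheaf.
Variable K : fieldType.
Local Notation S := {mpoly K[3]}.
Variables (T : fieldType) (tf : {rmorphism S -> T}).
Hypothesis tf_inj : injective tf.
Local Notation L := (locpart tf).
Local Notation X := (frac_var tf).
Implicit Types (J : {set 'I_3}) (k : int) (t : T).

Lemma coef_XnM_lt (i : 'I_3) m (q : S) (nu : 'X_{1..3}) :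
  (nu i < m)%N -> ('X_i ^+ m * q)@_nu = 0.
Proof.
move=> h; rewrite mpolyXn; apply: memN_msupp_eq0; apply/negP => hm.
have [mu _ nuE] : exists2 mu, mu \in msupp q & nu = (U_(i) *+ m + mu)%MM.
  by move/msuppM_le: hm => /allpairsP[[a b] /= [ha hb ->]]; exists b; move: ha;
    rewrite ?msuppX ?inE // => /eqP->.
by move: h; rewrite nuE mnmDE mulmnE mnm1E eqxx mul1n ltnNge leq_addr.
Qed.

Lemma coef_XnM (i : 'I_3) m (q : S) (nu : 'X_{1..3}) :
  ('X_i ^+ m * q)@_(nu + U_(i) *+ m)%MM = q@_nu.
Proof. by rewrite mulrC mpolyXn addmC mcoeffMX. Qed.

(** Division monomial by monomial. The remainder is described by its coefficients, so that the
    vanishing of an iterated remainder can be read off the exponents. *)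
Lemma split_Xn (i : 'I_3) m e (v : S) : (m <= e)%N -> v \is e.-homog ->
  exists q r : S, [/\ q \is (e - m).-homog, v = 'X_i ^+ m * q + r &
    forall nu, r@_nu = v@_nu *+ (nu i < m)].
Proof.
move=> me; move: v; apply: homog_ind => [|p p' [q [r [hq hp hr]]] [q' [r' [hq' hp'
  hr']]]|c mu hmu].
- exists 0, 0; rewrite dhomog0 mulr0 addr0; split=> // nu.
  by rewrite mcoeff0 mul0rn.
- exists (q + q'), (r + r'); split; first exact: dhomogD.
    by rewrite hp hp'; ring.
  by move=> nu; rewrite !mcoeffD hr hr' mulrnDl.
have [him|him] := ltnP (mu i) m.
  exists 0, (c *: 'X_[mu]); rewrite dhomog0 mulr0 add0r; split=> // nu.
  by rewrite mcoeffZ mcoeffX; case: eqP => [<-|_]; rewrite ?him ?mulr0 ?mul0rn.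
have le : (U_(i) *+ m <= mu)%MM.
  apply/mnm_lepP => j; rewrite mulmnE mnm1E.
  by case: eqP => [<-|_]; rewrite ?mul1n ?mul0n.
have muE := submK le.
exists (c *: 'X_[mu - U_(i) *+ m]), 0; split.
- rewrite dhomogZ // dhomogX; apply/eqP.
  have := congr1 mdeg muE; rewrite mdegD mdegMn mdeg1 mul1n hmu => <-.
  by rewrite addnK.
- by rewrite addr0 mpolyXn -scalerAr -mpolyXD addmC muE.
- move=> nu; rewrite mcoeff0 mcoeffZ mcoeffX; case: eqP => [<-|_].
    by rewrite ltnNge him mulr0n.
  by rewrite mulr0 mul0rn.
Qed.

Lemma mon2 (i j : 'I_3) : i != j -> mon K [set i; j] = 'X_i * 'X_j.
Proof. by move=> ij; rewrite /mon big_setU1 ?inE //= big_set1. Qed.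

Lemma mon3 : mon K setT = 'X_0 * 'X_1 * 'X_2.
Proof.
rewrite /mon (eq_bigl xpredT) => [|i]; last by rewrite inE.
rewrite !big_ord_recl big_ord0 mulr1 mulrA.
by congr ('X_ _ * 'X_ _ * 'X_ _); apply: val_inj.
Qed.

Lemma tf_mon2 (i j : 'I_3) m : i != j -> tf (mon K [set i;
  j] ^+ m) = X i ^+ m * X j ^+ m.
Proof. by move=> ij; rewrite mon2 // rmorphXn /= rmorphM /= exprMn. Qed.

Lemma tf_mon3 m : tf (mon K setT ^+ m) = X 0 ^+ m * X 1 ^+ m * X 2 ^+ m.
Proof. by rewrite mon3 rmorphXn /= !rmorphM /= !exprMn. Qed.

Lemma tf_mon1 (i : 'I_3) m : tf (mon K [set i] ^+ m) = X i ^+ m.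
Proof. by rewrite mon1 rmorphXn. Qed.

Lemma locpart_rep J k t : L J k t -> exists m0, forall m, (m0 <= m)%N ->
  exists e v, [/\ v \is e.-homog, e%:Z = k + (m * #|J|)%N%:Z &
      tf v = tf (mon K J ^+ m) * t].
Proof.
move=> /(locpart_raise tf_inj)[m0 h]; exists m0 => m /h [e [v [hv he ->]]].
by exists e, v; split=> //; rewrite mulVKf // tf_mon_neq0.
Qed.

Lemma locpart_of J k t m e (v : S) : v \is e.-homog ->
  e%:Z = k + (m * #|J|)%N%:Z -> tf v = tf (mon K J ^+ m) * t -> L J k t.
Proof.
move=> hv he ht; exists m, e, v; split=> //.
by rewrite ht mulKf // tf_mon_neq0.
Qed.

(** Comparing the two fractions gives x_j^m v = x_i^m w. Multiplication by x_j^m does not change the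
    exponent of x_i, so every monomial of [v] is already divisible by x_i^m. *)
Lemma locpart_setI (i j l : 'I_3) k t : i != j -> i != l -> j != l ->
  L [set i; l] k t -> L [set j; l] k t -> L [set l] k t.
Proof.
move=> ij il jl /locpart_rep[m0 h0] /locpart_rep[m1 h1].
(* With [m >= |k|] the numerators, of degree k + 2m, have degree at least m, as [split_Xn]
   requires. *)
pose m := maxn (maxn m0 m1) (absz k).
have [|e [v [hv he tE]]] := h0 m; first lia.
have [|e' [w [hw he' tE']]] := h1 m; first lia.
move: he he'; rewrite !cards2 il jl /= => he he'.
have me : (m <= e)%N by lia.
have [q [r [hq vE hr]]] := split_Xn i me hv.
have vw : 'X_j ^+ m * v = 'X_i ^+ m * w.
  apply: tf_inj; rewrite !rmorphM !rmorphXn /= tE tE' !tf_mon2 //.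
  by rewrite -!/(X _); ring.
have r0 : r = 0.
  apply/mpolyP => nu; rewrite hr mcoeff0; case: ltnP => //= nm.
  rewrite mulr1n -(coef_XnM j m) vw coef_XnM_lt // mnmDE mulmnE mnm1E.
  by rewrite eq_sym (negPf ij) mul0n addn0.
apply: (@locpart_of _ _ _ m _ q hq); first by rewrite cards1; lia.
apply: (mulfI (expf_neq0 m (frac_var_neq0 tf_inj i))).
by rewrite tf_mon1 mulrA -tf_mon2 // -tE vE r0 addr0 rmorphM rmorphXn.
Qed.

(** H^1(O(k)) = 0 for all k. The numerator of [c01] is divided by x_0^m, then by x_1^m: the cocycle
    relation kills the last remainder, and the quotients give [b1] and [b0]. Then c02 + b0 = c12 +
    b1 can only have a pole along x_2 = 0. *)
Lemma cechO_H1 k (c01 c02 c12 : T) :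
    L [set 0; 1] k c01 -> L [set 0; 2] k c02 -> L [set 1; 2] k c12 ->
    c12 - c02 + c01 = 0 ->
  exists b0 b1 b2, [/\ L [set 0] k b0, L [set 1] k b1, L [set 2] k b2 &
    [/\ c01 = b1 - b0, c02 = b2 - b0 & c12 = b2 - b1]].
Proof.
move=> h01 h02 h12 hc.
have [m0 r0] := locpart_rep h01; have [m1 r1] := locpart_rep h02.
have [m2 r2] := locpart_rep h12.
pose m := maxn (maxn m0 m1) (maxn m2 (absz k)).
have [|e [v [hv he vE]]] := r0 m; first lia.
have [|e' [w [hw he' wE]]] := r1 m; first lia.
have [|e'' [u [hu he'' uE]]] := r2 m; first lia.
move: he he' he''; rewrite !cards2 /= => he he' he''.
have me : (m <= e)%N by lia.
have [q0 [s0 [hq0 vE0 hs0]]] := split_Xn 0 me hv.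
have hs : s0 \is e.-homog.
  rewrite (_ : s0 = v - 'X_0 ^+ m * q0); last by rewrite vE0; ring.
  by rewrite rpredB // -(subnKC me) dhomogM // Xn_homog.
have [q1 [s1 [hq1 vE1 hs1]]] := split_Xn 1 me hs.
have rel : 'X_2 ^+ m * v = 'X_1 ^+ m * w - 'X_0 ^+ m * u.
  apply: tf_inj; rewrite rmorphB !rmorphM !rmorphXn /= vE wE uE !tf_mon2 //.
  have -> : c01 = c02 - c12 by rewrite -[LHS]subr0 -hc; ring.
  by rewrite -!/(X _); ring.
have s10 : s1 = 0.
  apply/mpolyP => nu; rewrite hs1 mcoeff0; case: ltnP => //= n1.
  rewrite mulr1n hs0; case: ltnP => //= n0.
  rewrite mulr1n -(coef_XnM 2 m) rel mcoeffB !coef_XnM_lt ?subr0 //.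
    by rewrite mnmDE mulmnE mnm1E addn0.
  by rewrite mnmDE mulmnE mnm1E addn0.
pose b1 := tf q0 / X 1 ^+ m; pose b0 := - (tf q1 / X 0 ^+ m).
have X0 (i : 'I_3) := frac_var_neq0 tf_inj i.
have hb1 : L [set 1] k b1.
  apply: (@locpart_of _ _ _ m _ q0 hq0); first by rewrite cards1; lia.
  by rewrite tf_mon1 /b1; field; rewrite ?expf_neq0 ?X0.
have hb0 : L [set 0] k b0.
  apply/locpartN/(@locpart_of _ _ _ m _ q1 hq1); first by rewrite cards1; lia.
  by rewrite tf_mon1; field; rewrite ?expf_neq0 ?X0.
have c01E : c01 = b1 - b0.
  apply: (mulfI (tf_mon_neq0 tf_inj [set 0; 1] m));
    rewrite -vE tf_mon2 // vE0 vE1 s10 addr0.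
  rewrite rmorphD !rmorphM !rmorphXn /= -!/(X _) /b1 /b0; field.
  by rewrite ?expf_neq0 ?X0.
have hb2 : L [set 2] k (c02 + b0).
  apply: (@locpart_setI 0 1 2) ; [exact: isT|exact: isT|exact: isT| |].
    by apply: (locpartD tf_inj h02); apply: (locpart_sub tf_inj _ hb0);
      rewrite sub1set !inE.
  rewrite (_ : c02 + b0 = c12 + b1).
    by apply: (locpartD tf_inj h12); apply: (locpart_sub tf_inj _ hb1);
      rewrite sub1set !inE.
  have -> : c02 = c12 + c01 by rewrite -[LHS]addr0 -hc; ring.
  by rewrite c01E; ring.
exists b0, b1, (c02 + b0); split; [exact: hb0|exact: hb1|exact: hb2|split].
- exact: c01E.
- by ring.
have -> : c02 = c12 + c01 by rewrite -[LHS]addr0 -hc; ring.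
by rewrite c01E; ring.
Qed.

(** H^2(O(k)) = 0 for k >= -2: the numerator has degree 3m + k >= 3m - 2, while a monomial outside
    the ideal (x_0^m, x_1^m, x_2^m) has degree at most 3m - 3. *)
Lemma cechO_H2 k t : -2 <= k -> L setT k t ->
  exists b01 b02 b12, [/\ L [set 0; 1] k b01, L [set 0; 2] k b02,
    L [set 1; 2] k b12 & t = b12 - b02 + b01].
Proof.
move=> k2 /locpart_rep[m0 r0].
pose m := maxn m0 (absz k); have [|e [v [hv he vE]]] := r0 m; first lia.
move: he; rewrite cardsT card_ord => he; have me : (m <= e)%N by lia.
have [q0 [s0 [hq0 vE0 hs0]]] := split_Xn 0 me hv.
have hh (i : 'I_3) (q s v' : S) : v' \is e.-homog -> q \is (e - m).-homog ->
  v' = 'X_i ^+ m * q + s -> s \is e.-homog.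
  move=> hv' hq v'E; rewrite (_ : s = v' - 'X_i ^+ m * q); last by rewrite v'E; ring.
  by rewrite rpredB // -(subnKC me) dhomogM // Xn_homog.
have hs0' := hh _ _ _ _ hv hq0 vE0.
have [q1 [s1 [hq1 vE1 hs1]]] := split_Xn 1 me hs0'.
have hs1' := hh _ _ _ _ hs0' hq1 vE1.
have [q2 [s2 [hq2 vE2 hs2]]] := split_Xn 2 me hs1'.
have s20 : s2 = 0.
  apply/mpolyP => nu; rewrite hs2 mcoeff0; case: ltnP => //= n2.
  rewrite mulr1n hs1; case: ltnP => //= n1; rewrite mulr1n hs0; case: ltnP => //= n0.
  rewrite mulr1n; apply: (dhomog_nemf_coeff hv); apply/eqP => hd.
  have : (nu 0%R + nu 1%R + nu 2%R = e)%N.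
    by rewrite -hd [RHS]mdegE !big_ord_recl big_ord0 addn0 addnA;
      congr (nu _ + nu _ + nu _)%N; apply: val_inj.
  by move: n0 n1 n2 he k2; lia.
have X0 (i : 'I_3) := frac_var_neq0 tf_inj i.
have B (i j : 'I_3) q : i != j -> q \is (e - m).-homog -> L [set i;
  j] k (tf q / (X i ^+ m * X j ^+ m)).
  move=> ij hq; apply: (@locpart_of _ _ _ m _ q hq); first by rewrite cards2 ij; lia.
  by rewrite tf_mon2 //; field; rewrite ?expf_neq0 ?X0.
exists (tf q2 / (X 0 ^+ m * X 1 ^+ m)), (- (tf q1 / (X 0 ^+ m * X 2 ^+ m))),
  (tf q0 / (X 1 ^+ m * X 2 ^+ m)).
split; [exact: B| apply: locpartN; exact: B|exact: B|].
apply: (mulfI (tf_mon_neq0 tf_inj setT m)); rewrite -vE tf_mon3 vE0 vE1 vE2 s20 addr0.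
rewrite !rmorphD !rmorphM !rmorphXn /= -!/(X _); field.
by rewrite ?expf_neq0 ?X0.
Qed.
End StructureSheaf.

(** * Affine charts *)

Section VariableDivision.
Variables (K : fieldType) (n : nat) (i : 'I_n).
Local Notation S := {mpoly K[n]}.

Definition kill_var : S -> S
  := mmap (@mpolyC n K) (fun a => if a == i then 0 else 'X_a).
HB.instance Definition _ := GRing.RMorphism.copy kill_var
  (mmap (@mpolyC n K) (fun a => if a == i then 0 else 'X_a)).

Lemma kill_varM : {morph kill_var : u v / u * v}.
Proof. exact: rmorphM. Qed.

Lemma kill_varP (v : S) : exists q, v = 'X_i * q + kill_var v.
Proof.
elim/mpolyind: v => [|c m p _ _ [q pE]]; first by exists 0;
  rewrite rmorph0 mulr0 addr0.
have [q' mE] : exists q', 'X_[m] = 'X_i * q' + kill_var 'X_[m].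
  rewrite /kill_var mmapX /mmap1; have [mi|mi] := eqVneq (m i) 0%N.
    exists 0; rewrite mulr0 add0r mpolyXE_id; apply: eq_bigr => a _.
    by case: eqP => // ->; rewrite mi !expr0.
  exists 'X_[m - U_(i)].
  rewrite -mpolyXD addmC submK ?lep1mP // (bigD1 i) //= eqxx expr0n (negPf mi).
  by rewrite mul0r addr0.
exists (c *: q' + q).
have -> : kill_var (c *: 'X_[m] + p) = c%:MP * kill_var 'X_[m] + kill_var p.
  by rewrite [LHS]mmapD mmapZ.
by rewrite {1}mE {1}pE -!mul_mpolyC; ring.
Qed.

Lemma kill_var_eq0 (v : S) : kill_var v = 0 -> exists q, v = 'X_i * q.
Proof. by case: (kill_varP v) => q vE v0; exists q; rewrite vE v0 addr0. Qed.

(** The hypothesis says that the prime x_i does not divide [u], so x_i divides [h] and can be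
    cancelled. *)
Lemma Xvar_cancel (N : nat) (f u h : S) : kill_var u != 0 ->
  'X_i ^+ N * f = u * h -> exists h', f = u * h'.
Proof.
move=> u0; elim: N h => [|N IH] h; first by rewrite mul1r; exists h.
rewrite exprS -mulrA => fE.
have : kill_var (u * h) = 0.
  rewrite -fE kill_varM [X in X * _]mmapX mmap1U eqxx mul0r //.
rewrite kill_varM => /eqP; rewrite mulf_eq0 (negPf u0) => /eqP/kill_var_eq0[h' hE].
apply: (IH h'); apply: (@mulfI _ 'X_i); first by rewrite -msize_poly_eq0 msizeX.
by rewrite fE hE; ring.
Qed.

Lemma Xvar_part (v : S) : v != 0 ->
  exists a v', v = 'X_i ^+ a * v' /\ kill_var v' != 0.
Proof.
have [k] := ubnP (msize v); elim: k v => // k IH v hv v0.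
have [/kill_var_eq0[q vE]|h] := eqVneq (kill_var v) 0; last first.
  by exists 0%N, v; rewrite mul1r.
have q0 : q != 0 by apply: contraNneq v0 => q0; rewrite vE q0 mulr0.
have X0 : 'X_i != 0 :> S by rewrite -msize_poly_eq0 msizeX.
have [|a [v' [qE hv']]] := IH q _ q0.
  by move: hv; rewrite vE msizeM // msizeX mdeg1 /= ltnS.
by exists a.+1, v'; split=> //; rewrite vE qE exprS mulrA.
Qed.
End VariableDivision.

Section Chart.
Variable K : closedFieldType.
Local Notation S := {mpoly K[3]}.
Local Notation B := {poly {poly K}}.
Variables (T : fieldType) (tf : {rmorphism S -> T}).
Hypothesis tf_inj : injective tf.
Local Notation L := (locpart tf).
Local Notation X := (frac_var tf).
Variables i j l : 'I_3.
Hypotheses (ij : i != j) (il : i != l) (jl : j != l).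

(* In the chart [x_i = 1], [x_j] and [x_l] become the inner and the outer
   variable of [B]; [chart_val] sends them to [x_j / x_i] and [x_l / x_i]. *)
Definition frac_const : K -> T := tf \o @mpolyC 3 K.
HB.instance Definition _ := GRing.RMorphism.copy frac_const (tf \o @mpolyC 3 K).
Definition chart_val (b : B) : T :=
  (map_poly (horner_eval (X j / X i) \o map_poly frac_const) b).[X l / X i].
HB.instance Definition _ := GRing.RMorphism.copy chart_val
  (horner_eval (X l / X i) \o map_poly (horner_eval (X j / X i) \o map_poly
    frac_const)).
Definition chart_var (a : 'I_3) : B :=
  if a == i then 1 else if a == j then 'X%:P else 'X.
Definition dehom : S -> B := mmap (polyC \o polyC) chart_var.
HB.instance Definition _ := GRing.RMorphism.copy dehom (mmap (polyC \o polyC)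
  chart_var).

Lemma chart_valM : {morph chart_val : a b / a * b}. Proof. exact: rmorphM. Qed.
Lemma chart_valD : {morph chart_val : a b / a + b}. Proof. exact: rmorphD. Qed.
Lemma dehomM : {morph dehom : a b / a * b}. Proof. exact: rmorphM. Qed.
Lemma dehomD : {morph dehom : a b / a + b}. Proof. exact: rmorphD. Qed.

Lemma chart_valC (p : {poly K})
  : chart_val p%:P = (map_poly frac_const p).[X j / X i].
Proof. by rewrite /chart_val map_polyC hornerC. Qed.

Lemma chart_valCC (c : K) : chart_val c%:P%:P = tf c%:MP.
Proof. by rewrite chart_valC map_polyC hornerC. Qed.

Lemma chart_valX : chart_val 'X = X l / X i.
Proof. by rewrite /chart_val map_polyX hornerX. Qed.

Lemma chart_valXC : chart_val 'X%:P = X j / X i.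
Proof. by rewrite chart_valC map_polyX hornerX. Qed.

Lemma chart_val_map (p : {poly K})
  : chart_val (map_poly polyC p) = (map_poly frac_const p).[X l / X i].
Proof.
rewrite /chart_val -map_poly_comp; congr (_.[_]); apply: eq_map_poly => c /=.
by rewrite map_polyC /horner_eval hornerC.
Qed.

Lemma chart_val_chart_var a : chart_val (chart_var a) = X a / X i.
Proof.
have Xi := frac_var_neq0 tf_inj i.
rewrite /chart_var; have [->|ai] := eqVneq a i; first by rewrite rmorph1 mulfV.
have [->|aj] := eqVneq a j; first exact: chart_valXC.
rewrite chart_valX; congr (X _ / _).
move: ij il jl ai aj; rewrite -!val_eqE /= => h1 h2 h3 h4 h5; apply: val_inj => /=.
by move: (ltn_ord a) (ltn_ord i) (ltn_ord j) (ltn_ord l); lia.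
Qed.

Lemma chart_val_dehom e (v : S) : v \is e.-homog ->
  chart_val (dehom v) = tf v / X i ^+ e.
Proof.
have Xi := frac_var_neq0 tf_inj i.
move: v; apply: homog_ind => [|p q hp hq|c m hm].
- by rewrite !rmorph0 mul0r.
- by rewrite dehomD chart_valD hp hq rmorphD mulrDl.
rewrite /dehom mmapZ mmapX chart_valM /= chart_valCC /mmap1 rmorph_prod.
rewrite -mul_mpolyC rmorphM -mulrA; congr (_ * _).
rewrite -hm mdegE mpolyXE_id rmorph_prod -prodrXr -prodf_div.
by apply: eq_bigr => a _; rewrite !rmorphXn /= chart_val_chart_var expr_div_n.
Qed.

(** All large degrees are offered so that two homogenizations can be added in the same degree; the
    clause [dehom v = b] is what makes [chart_val] injective. *)
Lemma homogenize (b : B) : exists n0, forall n, (n0 <= n)%N ->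
  exists v : S, [/\ v \is n.-homog, tf v = X i ^+ n * chart_val b & dehom v = b].
Proof.
have Xi := frac_var_neq0 tf_inj i.
pose P (b : B) := exists n0, forall n, (n0 <= n)%N ->
  exists v : S, [/\ v \is n.-homog, tf v = X i ^+ n * chart_val b & dehom v = b].
have PM b1 b2 : P b1 -> P b2 -> P (b1 * b2).
  case=> n1 h1 [n2 h2]; exists (n1 + n2)%N => n hn.
  have [|v1 [hv1 vE1 d1]] := h1 n1; first by [].
  have [|v2 [hv2 vE2 d2]] := h2 (n - n1)%N; first by lia.
  exists (v1 * v2); split; last by rewrite dehomM d1 d2.
    by rewrite -(subnKC (leq_trans (leq_addr _ _) hn)) dhomogM.
  rewrite -{1}(subnKC (leq_trans (leq_addr _ _) hn)) exprD chart_valM rmorphM /=.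
  by rewrite vE1 vE2; ring.
have PD b1 b2 : P b1 -> P b2 -> P (b1 + b2).
  case=> n1 h1 [n2 h2]; exists (n1 + n2)%N => n hn.
  have [|v1 [hv1 vE1 d1]] := h1 n; first by lia.
  have [|v2 [hv2 vE2 d2]] := h2 n; first by lia.
  exists (v1 + v2); split; last by rewrite dehomD d1 d2.
    exact: dhomogD.
  by rewrite chart_valD rmorphD /= vE1 vE2 mulrDr.
have PC c : P c%:P%:P.
  exists 0%N => n _; exists (c%:MP * 'X_i ^+ n); split.
  - by rewrite mul_mpolyC dhomogZ // Xn_homog.
  - by rewrite chart_valCC rmorphM rmorphXn mulrC.
  - rewrite dehomM rmorphXn /= /dehom mmapC mmapX mmap1U /chart_var eqxx.
    by rewrite expr1n mulr1.
have PV a : P (chart_var a).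
  exists 1%N => -[//|n] _; exists ('X_a * 'X_i ^+ n); split.
  - rewrite -[n.+1]add1n dhomogM ?Xn_homog // dhomogX; apply/eqP; exact: mdeg1.
  - rewrite chart_val_chart_var rmorphM rmorphXn /= -!/(X _) exprS; field.
    by rewrite Xi.
  - rewrite dehomM rmorphXn /= /dehom !mmapX !mmap1U {2}/chart_var eqxx.
    by rewrite expr1n mulr1.
have PX : P 'X by have := PV l; rewrite /chart_var !(eq_sym l) (negPf il) (negPf jl).
have PY : P 'X%:P by have := PV j; rewrite /chart_var !(eq_sym j) (negPf ij) eqxx.
have PA (a : {poly K}) : P a%:P.
  elim/poly_ind: a => [|a c IH]; first exact: (PC 0).
  by rewrite polyCD polyCM; apply: PD; [exact: PM|exact: PC].
rewrite -/(P b); elim/poly_ind: b => [|a c IH]; first exact: (PC 0).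
by apply: PD; [exact: PM|exact: PA].
Qed.

Lemma chart_val_inj : injective chart_val.
Proof.
move=> a b ab; apply/eqP; rewrite -subr_eq0; apply/eqP.
have [n0 /(_ _ (leqnn n0))[v [_ vE <-]]] := homogenize (a - b).
suff -> : v = 0 by rewrite rmorph0.
by apply: tf_inj; rewrite vE rmorphB /= ab subrr mulr0 rmorph0.
Qed.

Lemma locpart_chart_val b : L [set i] 0 (chart_val b).
Proof.
have [n /(_ _ (leqnn n))[v [hv vE _]]] := homogenize b.
apply: (locpart_of tf_inj (m := n) hv); first by rewrite cards1 muln1.
by rewrite tf_mon1.
Qed.

Lemma locpart_horner (J : {set 'I_3}) (p : {poly K}) : i \in J ->
  L J 0 (map_poly frac_const p).[X j / X i].
Proof.
move=> iJ; rewrite -chart_valC; apply: (locpart_sub tf_inj _ (locpart_chart_val _)).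
by rewrite sub1set.
Qed.
End Chart.

(** * Coprimality of the two equations on each chart *)

Section Coprime.
Variable K : closedFieldType.
Local Notation S := {mpoly K[3]}.
Variables (T : fieldType) (tf : {rmorphism S -> T}).
Hypothesis tf_inj : injective tf.
Local Notation L := (locpart tf).
Local Notation X := (frac_var tf).
Variables (f g : S) (d e : nat).
Hypotheses (f_homog : f \is d.-homog) (g_homog : g \is e.-homog).
Hypothesis fg_squarefree : squarefree_elt (f * g).

(** Homogenized, a common factor has its square dividing f g up to powers of x_i, which the chart
    does not see. Once x_i is removed from it, its square divides f g, and squarefreeness makes it
    constant. *)
Lemma dehom_coprime (i j l : 'I_3) (D U V : {poly {poly K}}) :
    i != j -> i != l -> j != l ->
  dehom i j f = D * U -> dehom i j g = D * V -> (size D <= 1)%N.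
Proof.
move=> ij il jl fE gE; have Xi := frac_var_neq0 tf_inj i.
have [fg0 sqf] := fg_squarefree; move: (fg0);
  rewrite mulf_eq0 negb_or => /andP[f0 g0].
have [n /(_ _ (leqnn n))[v [hv vE dv]]] := homogenize tf_inj ij il jl D.
have [m /(_ _ (leqnn m))[h [hh hE _]]] := homogenize tf_inj ij il jl (U * V).
have rel : 'X_i ^+ (n + n + m) * (f * g) = 'X_i ^+ (d + e) * (v ^+ 2 * h).
  apply: tf_inj; rewrite !rmorphM !rmorphXn /= -!/(X _) vE hE chart_valM.
  have := chart_val_dehom tf_inj ij il jl f_homog; rewrite fE chart_valM => fE'.
  have := chart_val_dehom tf_inj ij il jl g_homog; rewrite gE chart_valM => gE'.
  have -> : tf f = chart_val tf i j l D * chart_val tf i j l U * X i ^+ d.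
    by rewrite fE' divfK // expf_neq0.
  have -> : tf g = chart_val tf i j l D * chart_val tf i j l V * X i ^+ e.
    by rewrite gE' divfK // expf_neq0.
  by rewrite !exprD; ring.
have D0 : D != 0.
  apply: contraNneq f0 => D0; rewrite -(tf_eq0 tf_inj).
  have := chart_val_dehom tf_inj ij il jl f_homog;
    rewrite fE D0 mul0r rmorph0 => /esym/eqP.
  by rewrite mulf_eq0 invr_eq0 expf_eq0 (negPf Xi) andbF orbF.
have v0 : v != 0 by apply: contraNneq D0 => v0; rewrite -dv v0 rmorph0.
have [a [v' [v'E kv']]] := Xvar_part i v0.
have [h' fgE] : exists h', f * g = v' ^+ 2 * h'.
  apply: (@Xvar_cancel _ _ i (n + n + m) _ _ ('X_i ^+ (d + e + a + a) * h)).
    by rewrite expr2 kill_varM mulf_neq0.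
  by rewrite rel v'E !exprD; ring.
have v'unit : v' \is a GRing.unit by apply: (sqf _ h'); rewrite fgE mulrC.
have [c v'C] : exists c, v' = c%:MP.
  by move: v'unit => /andP[/eqP -> _]; eexists.
rewrite -dv v'E dehomM rmorphXn v'C /= /dehom mmapX mmap1U mmapC /chart_var eqxx.
by rewrite expr1n mul1r /= size_polyC; case: eqP.
Qed.

Lemma chart_bezout (i j : 'I_3) : i != j ->
  exists (p : {poly K}) (a b : T), [/\ p != 0, L [set i] (- d%:Z) a,
    L [set i] (- e%:Z) b &
    (map_poly (frac_const tf) p).[X j / X i] = a * tf f + b * tf g].
Proof.
move=> ij; have [l [il jl]] : exists l : 'I_3, i != l /\ j != l.
  by move: ij; case: (ord3P i) => ->; case: (ord3P j) => -> // _;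
     [exists 2|exists 1|exists 2|exists 0|exists 1|exists 0].
have [fg0 _] := fg_squarefree; move: (fg0); rewrite mulf_eq0 negb_or => /andP[f0 g0].
have Xi := frac_var_neq0 tf_inj i.
have fE := chart_val_dehom tf_inj ij il jl f_homog.
have gE := chart_val_dehom tf_inj ij il jl g_homog.
have [||p [a [b [p0 pE]]]] := @coprime_bezout _ (dehom i j f) (dehom i j g).
- apply: contraNneq f0 => D0; rewrite -(tf_eq0 tf_inj).
  move: fE; rewrite D0 rmorph0 => /esym/eqP.
  by rewrite mulf_eq0 invr_eq0 expf_eq0 (negPf Xi) andbF orbF.
- by move=> D U V; exact: dehom_coprime ij il jl.
have loc n x : L [set i] (- n%:Z) (chart_val tf i j l x * X i ^- n).
  rewrite -exprVn -[- _]add0r;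
    apply: (locpartM tf_inj (locpart_chart_val tf_inj ij il jl x)).
  by rewrite -mulN1r; apply: (locpartXn tf_inj); apply: (locpartXV tf_inj);
    rewrite set11.
exists p, (chart_val tf i j l a * X i ^- d), (chart_val tf i j l b * X i ^- e);
  split=> //.
have := congr1 (chart_val tf i j l) pE;
  rewrite chart_valC chart_valD !chart_valM fE gE => ->.
by field; rewrite ?expf_neq0.
Qed.

(** [f], [g] is a regular sequence on each chart. One Bezout identity gives p u = g s, but [p] need
    not be invertible. The identity in the other coordinate gives q u = g s', hence p s' = q s;
    since [p] and [q] involve different variables, [p] divides [s], and u = g (s / p). *)
Lemma locpart_regular (J : {set 'I_3}) (i : 'I_3) k (u v : T) : i \in J ->
    L J k u -> L J (k + d%:Z - e%:Z) v -> tf f * u = tf g * v ->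
  exists2 w, L J (k - e%:Z) w & u = tf g * w.
Proof.
move=> iJ hu hv fu.
have [fg0 _] := fg_squarefree; move: (fg0); rewrite mulf_eq0 negb_or => /andP[f0 g0].
have tg0 : tf g != 0 by rewrite (tf_eq0 tf_inj).
have [j [l [ij il jl]]] : exists j l : 'I_3, [/\ i != j, i != l & j != l].
  by case: (ord3P i) => ->; [exists 1, 2|exists 0, 2|exists 0, 1].
have Xi := frac_var_neq0 tf_inj i.
have mon0 := tf_mon_neq0 tf_inj J.
have [p [a [b [p0 ha hb pE]]]] := chart_bezout ij.
have [q [a' [b' [q0 ha' hb' qE]]]] := chart_bezout il.
have subJ : [set i] \subset J by rewrite sub1set.
have locs (x y : T) : L [set i] (- d%:Z) x -> L [set i] (- e%:Z) y ->
    L J (k - e%:Z) (x * v + y * u).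
  move=> hx hy; apply: (locpartD tf_inj).
    rewrite (_ : k - e%:Z = - d%:Z + (k + d%:Z - e%:Z)); last by ring.
    exact: (locpartM tf_inj (locpart_sub tf_inj subJ hx) hv).
  by rewrite addrC; exact: (locpartM tf_inj (locpart_sub tf_inj subJ hy) hu).
have hs := locs _ _ ha hb; have hs' := locs _ _ ha' hb'.
set s := a * v + b * u in hs; set s' := a' * v + b' * u in hs'.
have pu : (map_poly (frac_const tf) p).[X j / X i] * u = tf g * s.
  by rewrite pE mulrDl -mulrA fu /s; ring.
have qu : (map_poly (frac_const tf) q).[X l / X i] * u = tf g * s'.
  by rewrite qE mulrDl -mulrA fu /s'; ring.
have [m0 r0] := locpart_rep tf_inj hs; have [m1 r1] := locpart_rep tf_inj hs'.
pose m := maxn m0 m1.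
have [|n [x [hx nE xE]]] := r0 m; first by rewrite leq_maxl.
have [|n' [x' [hx' nE' xE']]] := r1 m; first by rewrite leq_maxr.
have nn : n' = n by apply/eqP; rewrite -eqz_nat nE nE'.
rewrite nn in hx'.
have key : p%:P * dehom i j x' = map_poly polyC q * dehom i j x.
  apply: (chart_val_inj tf_inj ij il jl);
    rewrite !chart_valM chart_valC chart_val_map.
  rewrite !(chart_val_dehom tf_inj ij il jl (e := n)) // xE xE'.
  apply: (mulfI tg0).
  transitivity ((map_poly (frac_const tf) p).[X j / X i] * tf (mon K J ^+ m) / X i ^+
    n * (tf g * s')).
    by ring.
  rewrite -qu; transitivity ((map_poly (frac_const tf) q).[X l / X i] * tf (mon K J
    ^+ m) / X i ^+ n * (tf g * s)); last by ring.
  by rewrite -pu; ring.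
have [|W WE] := primitive_dvd p0 _ key.
  move=> c; rewrite /specialize -map_poly_comp map_poly_id //.
  by move=> y _ /=; rewrite /horner_eval hornerC.
have sE : s = (map_poly (frac_const tf) p).[X j / X i] * (chart_val tf i j l W * X i
  ^+ n / tf (mon K J ^+ m)).
  apply: (mulfI (mon0 m)); rewrite -xE.
  have -> : tf x = chart_val tf i j l (dehom i j x) * X i ^+ n.
    by rewrite (chart_val_dehom tf_inj ij il jl hx) divfK // expf_neq0.
  by rewrite WE chart_valM chart_valC; field.
exists (chart_val tf i j l W * X i ^+ n / tf (mon K J ^+ m)); last first.
  have pY0 : (map_poly (frac_const tf) p).[X j / X i] != 0.
    rewrite -(chart_valC tf i j l) -(rmorph0 (chart_val tf i j l)).
    by rewrite (inj_eq (chart_val_inj tf_inj ij il jl)) polyC_eq0.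
  by apply: (mulfI pY0); rewrite pu sE; ring.
rewrite (_ : k - e%:Z = 0 + 1 * n%:Z + - (m * #|J|)%N%:Z); last by rewrite nE; ring.
apply: (locpartM tf_inj _ (locpart_monV tf J m)); apply: (locpartM tf_inj).
  exact: (locpart_sub tf_inj subJ (locpart_chart_val tf_inj ij il jl _)).
by apply: (locpartXn tf_inj); exact: (locpartX tf).
Qed.

(* [X_j ^ m * theta] behaves as an idempotent on the sheaves supported on the
   finite scheme [f = g = 0]: it is [1] where [x_j] is invertible. *)
Lemma separating_section (i j : 'I_3) (m : nat) : i != j ->
  exists theta a b : T, [/\ L [set i] (- m%:Z) theta,
    L [set i; j] (- d%:Z) a, L [set i; j] (- e%:Z) b &
    1 - X j ^+ m * theta = a * tf f + b * tf g].
Proof.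
move=> ij; have [p [a [b [p0 ha hb pE]]]] := chart_bezout ij.
have Xi := frac_var_neq0 tf_inj i; have Xj := frac_var_neq0 tf_inj j.
(* Write y = x_j / x_i and p = q y^n with q(0) != 0. Then u y^m + v q = 1, and [theta] is u(y) /
   x_i^m. The other term v q is (v / y^n) p, a combination of [f] and [g] over D_+(x_i x_j), where y
   is invertible. *)
have [n [q /implyP q0 pq]] := multiplicity_XsubC p 0; rewrite p0 subr0 /= in q0 pq.
have /Bezout_eq1_coprimepP[[u v] /= uv] : coprimep ('X^m) q.
  by rewrite coprimep_expl // coprimep_sym coprimepX; exact: q0.
pose ev (r : {poly K}) := (map_poly (frac_const tf) r).[X j / X i].
have ij2 : [set i] \subset [set i; j] by rewrite sub1set !inE eqxx.
have evL r : L [set i] 0 (ev r).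
  have [l [il jl]] : exists l : 'I_3, i != l /\ j != l.
    by move: ij; case: (ord3P i) => ->; case: (ord3P j) => -> // _;
       [exists 2|exists 1|exists 2|exists 0|exists 1|exists 0].
  by apply: (locpart_horner tf_inj ij il jl); rewrite set11.
pose c := ev v * (X i * (X j)^-1) ^+ n.
have hc : L [set i; j] 0 c.
  rewrite /c -[0]addr0; apply: (locpartM tf_inj);
    first exact: (locpart_sub tf_inj ij2 (evL v)).
  rewrite -[0](mul0r n%:Z); apply: (locpartXn tf_inj); rewrite -[0](subrr 1).
  by apply: (locpartM tf_inj); [exact: (locpartX tf)|apply: (locpartXV tf_inj);
    rewrite !inE eqxx orbT].
exists (ev u * (X i)^-1 ^+ m), (c * a), (c * b); split.
- rewrite -[- _]add0r; apply: (locpartM tf_inj (evL u)).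
  by rewrite -mulN1r; apply: (locpartXn tf_inj); apply: (locpartXV tf_inj);
    rewrite set11.
- rewrite -[- _]add0r; exact: (locpartM tf_inj hc (locpart_sub tf_inj ij2 ha)).
- rewrite -[- _]add0r; exact: (locpartM tf_inj hc (locpart_sub tf_inj ij2 hb)).
transitivity (c * ev p); last by rewrite /ev pE; ring.
have evD r1 r2 : ev (r1 + r2) = ev r1 + ev r2 by rewrite /ev rmorphD hornerD.
have evM r1 r2 : ev (r1 * r2) = ev r1 * ev r2 by rewrite /ev rmorphM hornerM.
have evX r : ev 'X^r = (X j / X i) ^+ r by rewrite /ev map_polyXn hornerXn.
have -> : 1 = ev (u * 'X^m + v * q) by rewrite uv /ev rmorph1 hornerC.
rewrite evD !evM pq evM !evX /c.
by rewrite !expr_div_n ?exprVn; field; rewrite ?expf_neq0 ?Xi ?Xj.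
Qed.

End Coprime.

(** * Derivations *)

Section Vectors.
Variable T : fieldType.
Implicit Types (u v w : 'rV[T]_3) (a : T).

Definition dot u v : T := \sum_i u 0 i * v 0 i.
Definition cross u v : 'rV[T]_3 := \row_i
  (if i == 0 then u 0 1 * v 0 2 - u 0 2 * v 0 1
   else if i == 1 then u 0 2 * v 0 0 - u 0 0 * v 0 2
   else u 0 0 * v 0 1 - u 0 1 * v 0 0).

Lemma dotC u v : dot u v = dot v u.
Proof. by apply: eq_bigr => i _; rewrite mulrC. Qed.
Lemma dotDl u v w : dot (u + v) w = dot u w + dot v w.
Proof. by rewrite -big_split; apply: eq_bigr => i _; rewrite mxE mulrDl. Qed.
Lemma dotZl a u v : dot (a *: u) v = a * dot u v.
Proof. by rewrite mulr_sumr; apply: eq_bigr => i _; rewrite mxE mulrA. Qed.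
Lemma dotNl u v : dot (- u) v = - dot u v.
Proof. by rewrite -scaleN1r dotZl mulN1r. Qed.
Lemma dotBl u v w : dot (u - v) w = dot u w - dot v w.
Proof. by rewrite dotDl dotNl. Qed.
Lemma dotDr u v w : dot w (u + v) = dot w u + dot w v.
Proof. by rewrite dotC dotDl !(dotC _ w). Qed.
Lemma dotZr a u v : dot v (a *: u) = a * dot v u.
Proof. by rewrite dotC dotZl dotC. Qed.
Lemma dot0l u : dot 0 u = 0.
Proof. by rewrite -(scale0r 0) dotZl mul0r. Qed.

Lemma crossC u v : cross u v = - cross v u.
Proof.
apply/rowP => i; rewrite !mxE; case: ifP => _; first by ring.
by case: ifP => _; ring.
Qed.
Lemma crossDl u v w : cross (u + v) w = cross u w + cross v w.
Proof.
apply/rowP => i; rewrite !mxE; case: ifP => _; first by ring.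
by case: ifP => _; ring.
Qed.
Lemma crossZl a u v : cross (a *: u) v = a *: cross u v.
Proof.
apply/rowP => i; rewrite !mxE; case: ifP => _; first by ring.
by case: ifP => _; ring.
Qed.
Lemma crossDr u v w : cross w (u + v) = cross w u + cross w v.
Proof. by rewrite crossC crossDl opprD -!crossC. Qed.
Lemma crossZr a u v : cross v (a *: u) = a *: cross v u.
Proof. by rewrite crossC crossZl -scalerN -crossC. Qed.
Lemma crossNr u v : cross v (- u) = - cross v u.
Proof. by rewrite -scaleN1r crossZr scaleN1r. Qed.
Lemma crossvv u : cross u u = 0.
Proof.
apply/rowP => i; rewrite !mxE; case: ifP => _; first by ring.
by case: ifP => _; ring.
Qed.

Lemma dot_crossl u v : dot (cross u v) u = 0.
Proof. by rewrite /dot sum3E !mxE /=; ring. Qed.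

Lemma crossCr u v w : cross u (cross v w) = dot u w *: v - dot u v *: w.
Proof.
apply/rowP => i; rewrite /dot !sum3E; case: (ord3P i) => ->;
by rewrite !mxE /= ?mxE /=; ring.
Qed.
Lemma crossCl u v w : cross (cross u v) w = dot u w *: v - dot v w *: u.
Proof. by rewrite crossC crossCr opprB !(dotC w). Qed.
End Vectors.

(** * Local sections of the syzygy sheaves *)

Section Syzygies.
Variable K : fieldType.
Local Notation S := {mpoly K[3]}.
Variables (T : fieldType) (tf : {rmorphism S -> T}).
Hypothesis tf_inj : injective tf.
Local Notation L := (locpart tf).
Local Notation X := (frac_var tf).
Implicit Types (J : {set 'I_3}) (k l : int) (w : 'rV[T]_3) (h : S).

Definition grad h : 'rV[T]_3 := \row_i tf (h^`M(i)).
Definition euler_vec : 'rV[T]_3 := \row_i X i.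
Definition locvec J k w : Prop := forall i, L J k (w 0 i).
(* Sections over [D_+(x_J)] of the sheaf of [D_0(h)], twisted by [k]. *)
Definition syz h J k w : Prop := locvec J k w /\ dot w (grad h) = 0.

Lemma locvecD J k u w : locvec J k u -> locvec J k w -> locvec J k (u + w).
Proof. by move=> hu hw i; rewrite mxE; exact: (locpartD tf_inj (hu i) (hw i)). Qed.
Lemma locvecZ J k l a w : L J k a -> locvec J l w -> locvec J (k + l) (a *: w).
Proof. by move=> ha hw i; rewrite mxE; exact: (locpartM tf_inj ha (hw i)). Qed.
Lemma locvecN J k w : locvec J k w -> locvec J k (- w).
Proof. by move=> hw i; rewrite mxE; exact: locpartN (hw i). Qed.
Lemma locvecB J k u w : locvec J k u -> locvec J k w -> locvec J k (u - w).
Proof. by move=> hu hw; apply: locvecD hu (locvecN hw). Qed.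
Lemma locvec_sub J J' k w : J \subset J' -> locvec J k w -> locvec J' k w.
Proof. by move=> hJ hw i; exact: (locpart_sub tf_inj hJ (hw i)). Qed.

Lemma locvec_dot J k l u w : locvec J k u -> locvec J l w -> L J (k + l) (dot u w).
Proof.
move=> hu hw; have p i := locpartM tf_inj (hu i) (hw i).
by rewrite /dot sum3E; apply: (locpartD tf_inj (locpartD tf_inj (p 0) (p 1)) (p 2)).
Qed.

Lemma locvec_cross J k l u w : locvec J k u -> locvec J l w ->
  locvec J (k + l) (cross u w).
Proof.
move=> hu hw i; have p a b := locpartM tf_inj (hu a) (hw b).
rewrite mxE; case: ifP => _; first exact: (locpartB tf_inj (p 1 2) (p 2 1)).
by case: ifP => _; [exact: (locpartB tf_inj (p 2 0) (p 0 2))|exact: (locpartB tf_inj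
  (p 0 1) (p 1 0))].
Qed.

Lemma locvec_clear J k j w : locvec (j |: J) k w ->
  exists m0, forall m, (m0 <= m)%N -> locvec J (k + m%:Z) (X j ^+ m *: w).
Proof.
move=> hw; have [m0 h0] := locpart_clear tf_inj (hw 0).
have [m1 h1] := locpart_clear tf_inj (hw 1); have [m2 h2]
  := locpart_clear tf_inj (hw 2).
exists (maxn m0 (maxn m1 m2)) => m;
  rewrite !geq_max => /and3P[/h0 {}h0 /h1 {}h1 /h2 {}h2] i.
by rewrite mxE; case: (ord3P i) => ->.
Qed.

Lemma locvec_eul J : locvec J 1 euler_vec.
Proof. by move=> i; rewrite mxE; exact: locpartX. Qed.

Lemma locvec_grad J h (e : nat) : h \is e.-homog -> (0 < e)%N ->
  locvec J (e%:Z - 1) (grad h).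
Proof.
case: e => // e hh _ i; rewrite mxE (_ : e.+1%:Z - 1 = e); last by lia.
by apply: locpart_homog; exact: mderiv_homog.
Qed.

Lemma tf_nat n : tf (n%:R)%:MP = n%:R.
Proof. by rewrite mpolyC_nat rmorph_nat. Qed.

Lemma locpart_natV J n : n%:R != 0 :> K -> L J 0 (n%:R^-1).
Proof.
move=> n0; rewrite (_ : n%:R^-1 = tf (n%:R^-1)%:MP); first exact: locpartC.
have nT : n%:R != 0 :> T by rewrite -tf_nat (tf_eq0 tf_inj) mpolyC_eq0.
apply: (mulfI nT); rewrite mulfV // -tf_nat -rmorphM -mpolyCM mulfV //.
by rewrite mpolyC1 rmorph1.
Qed.

Lemma dot_eul_grad h (e : nat) : h \is e.-homog ->
  dot euler_vec (grad h) = e%:R * tf h.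
Proof.
move=> hh; rewrite -(tf_nat e) -rmorphM mul_mpolyC -(euler hh) rmorph_sum.
by apply: eq_bigr => i _; rewrite !mxE rmorphM.
Qed.

Lemma gradM f g : grad (f * g) = tf g *: grad f + tf f *: grad g.
Proof.
apply/rowP => i; rewrite !mxE mderivM rmorphD !rmorphM /=; by ring.
Qed.

Lemma syzD h J k u w : syz h J k u -> syz h J k w -> syz h J k (u + w).
Proof. by move=> [u1 u2] [w1 w2]; split;
  [exact: locvecD|rewrite dotDl u2 w2 addr0]. Qed.
Lemma syzN h J k w : syz h J k w -> syz h J k (- w).
Proof. by move=> [w1 w2]; split; [exact: locvecN|rewrite dotNl w2 oppr0]. Qed.
Lemma syzB h J k u w : syz h J k u -> syz h J k w -> syz h J k (u - w).
Proof. by move=> hu hw; apply: syzD hu (syzN hw). Qed.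
Lemma syzZ h J k l a w : L J k a -> syz h J l w -> syz h J (k + l) (a *: w).
Proof. by move=> ha [w1 w2]; split; [exact: locvecZ|rewrite dotZl w2 mulr0]. Qed.
Lemma syz_sub h J J' k w : J \subset J' -> syz h J k w -> syz h J' k w.
Proof. by move=> hJ [w1 w2]; split=> //; exact: locvec_sub w1. Qed.
End Syzygies.

(** * Vanishing of cohomology *)

(* [M J] stands for the sections over [D_+(x_J)]. *)
Definition vanishH1 (V : zmodType) (M : {set 'I_3} -> V -> Prop) : Prop :=
  forall c01 c02 c12, M [set 0; 1] c01 -> M [set 0; 2] c02 -> M [set 1; 2] c12 ->
    c12 - c02 + c01 = 0 ->
  exists b0 b1 b2, [/\ M [set 0] b0, M [set 1] b1, M [set 2] b2 &
    [/\ c01 = b1 - b0, c02 = b2 - b0 & c12 = b2 - b1]].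
Definition vanishH2 (V : zmodType) (M : {set 'I_3} -> V -> Prop) : Prop :=
  forall c, M setT c -> exists b01 b02 b12, [/\ M [set 0; 1] b01,
    M [set 0; 2] b02, M [set 1; 2] b12 & c = b12 - b02 + b01].

Section Mumford.
Variable K : fieldType.
Local Notation S := {mpoly K[3]}.
Variables (T : fieldType) (tf : {rmorphism S -> T}).
Hypothesis tf_inj : injective tf.
Local Notation X := (frac_var tf).
Variables (h : S) (k : int).

Let XZ J i l w : syz tf h J l w -> syz tf h J (1 + l) (X i *: w).
Proof. exact: (syzZ tf_inj (locpartX tf J i)). Qed.
Let XVZ (J : {set 'I_3}) i l w : i \in J -> syz tf h J l w ->
  syz tf h J (-1 + l) ((X i)^-1 *: w).
Proof. by move=> iJ; apply: (syzZ tf_inj (locpartXV tf_inj iJ)). Qed.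
Let X0 i := frac_var_neq0 tf_inj i.

(** Over D_+(x_0 x_1 x_2) the section can be divided by x_0; the splitting found one degree lower is
    multiplied back. *)
Lemma vanishH2_step : vanishH2 (fun J => syz tf h J k) ->
  vanishH2 (fun J => syz tf h J (k + 1)).
Proof.
move=> hv c hc.
have : syz tf h setT k ((X 0)^-1 *: c).
  by rewrite (_ : k = -1 + (k + 1)); [apply: XVZ; rewrite ?inE|ring].
case/hv=> b01 [b02 [b12 [h01 h02 h12 cE]]].
exists (X 0 *: b01), (X 0 *: b02), (X 0 *: b12).
rewrite (addrC k); split; [exact: XZ|exact: XZ|exact: XZ|].
by rewrite -scalerBr -scalerDr -cE scalerA mulfV ?scale1r.
Qed.

(* A cocycle [c] of degree [k + 1] is [x_0 a + x_1 b] with cocycles [a] and [b]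
   of degree [k], by the Koszul complex of [x_0, x_1] over [D_+(x_0 x_1 x_2)]. *)
Lemma vanishH1_step : vanishH1 (fun J => syz tf h J k) ->
    vanishH2 (fun J => syz tf h J (k - 1)) ->
  vanishH1 (fun J => syz tf h J (k + 1)).
Proof.
move=> hv1 hv2 c01 c02 c12 h01 h02 h12 hc.
have c12E : c12 = c02 - c01.
  apply/eqP; rewrite -subr_eq0; apply/eqP; rewrite -[RHS]hc.
  by apply/rowP => i; rewrite !mxE; ring.
have sub (J : {set 'I_3}) : J \subset [set: 'I_3] by exact: subsetT.
have ht : syz tf h setT (k - 1) ((X 0)^-1 *: ((X 1)^-1 *: c12)).
  rewrite (_ : k - 1 = -1 + (-1 + (k + 1))); last by ring.
  by apply: XVZ; rewrite ?inE //; apply: XVZ; rewrite ?inE //;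
    exact: (syz_sub tf_inj (sub _) h12).
have [t01 [t02 [t12 [k01 k02 k12 tE]]]] := hv2 _ ht.
have dn (J : {set 'I_3}) i w : i \in J -> syz tf h J (k + 1) w ->
  syz tf h J k ((X i)^-1 *: w).
  by move=> iJ hw; rewrite (_ : k = -1 + (k + 1)); [exact: XVZ|ring].
have up J i w : syz tf h J (k - 1) w -> syz tf h J k (X i *: w).
  by move=> hw; rewrite (_ : k = 1 + (k - 1)); [exact: XZ|ring].
(* One would take a = c / x_0 and b = 0, but x_0 is not invertible on D_+(x_1 x_2), so there c12 /
   x_1 is put in [b]. The defect from being cocycles comes from c12 / (x_0 x_1); its splitting [t],
   times x_1 in [a] and -x_0 in [b], corrects both and leaves x_0 a + x_1 b unchanged. *)
have [] := hv1 ((X 0)^-1 *: c01 + X 1 *: t01) ((X 0)^-1 *: c02 + X 1 *: t02) (X 1 *: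
  t12).
- by apply: (syzD tf_inj); [apply: dn; rewrite ?inE|exact: up].
- by apply: (syzD tf_inj); [apply: dn; rewrite ?inE|exact: up].
- exact: up.
- rewrite (_ : _ + _ = X 1 *: (t12 - t02 + t01) - (X 0)^-1 *: (c02 - c01)).
    rewrite -tE -c12E !scalerA mulrCA mulfV // mulr1 subrr //.
  by apply/rowP => i; rewrite !mxE; ring.
move=> a0 [a1 [a2 [ha0 ha1 ha2 [e1 e2 e3]]]].
have [] := hv1 (- (X 0 *: t01)) (- (X 0 *: t02)) ((X 1)^-1 *: c12 - X 0 *: t12).
- by apply: syzN; exact: up.
- by apply: syzN; exact: up.
- by apply: (syzB tf_inj); [apply: dn; rewrite ?inE|exact: up].
- transitivity ((X 1)^-1 *: c12 - X 0 *: (t12 - t02 + t01)).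
    by apply/rowP => i; rewrite !mxE; ring.
  by rewrite -tE !scalerA mulrA mulfV // mul1r subrr.
move=> b0 [b1 [b2 [hb0 hb1 hb2 [e1' e2' e3']]]].
have glue J u v : syz tf h J k u -> syz tf h J k v ->
  syz tf h J (k + 1) (X 0 *: u + X 1 *: v).
  by move=> hu hv; rewrite addrC; apply: (syzD tf_inj); exact: XZ.
exists (X 0 *: a0 + X 1 *: b0), (X 0 *: a1 + X 1 *: b1), (X 0 *: a2 + X 1 *: b2).
split; [exact: glue|exact: glue|exact: glue|].
have lin (u u' v v' : 'rV[T]_3) : X 0 *: u + X 1 *: u' - (X 0 *: v + X 1 *: v') =
    X 0 *: (u - v) + X 1 *: (u' - v').
  by apply/rowP => i; rewrite !mxE; ring.
rewrite !lin -e1 -e2 -e3 -e1' -e2' -e3'; split.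
- by apply/rowP => i; rewrite !mxE; field; rewrite X0.
- by apply/rowP => i; rewrite !mxE; field; rewrite X0.
- by apply/rowP => i; rewrite !mxE; field; rewrite X0.
Qed.

End Mumford.

Lemma vanish_up (K T : fieldType) (tf : {rmorphism {mpoly K[3]} -> T})
    (tf_inj : injective tf) (h : {mpoly K[3]}) (k l : int) : k <= l ->
    vanishH1 (fun J => syz tf h J k) -> vanishH2 (fun J => syz tf h J (k - 1)) ->
  vanishH1 (fun J => syz tf h J l) /\ vanishH2 (fun J => syz tf h J (l - 1)).
Proof.
move=> kl h1 h2; have -> : l = k + (absz (l - k))%:Z by lia.
elim: (absz _) => [|n [IH1 IH2]]; first by rewrite addr0.
rewrite (_ : k + n.+1%:Z = k + n%:Z + 1); last by lia.
split; first exact: vanishH1_step.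
by rewrite (_ : _ - 1 = k + n%:Z - 1 + 1); [exact: vanishH2_step|ring].
Qed.

(** * Adding the smooth component *)

Section Addition.
Variable K : closedFieldType.
Local Notation S := {mpoly K[3]}.
Variables (T : fieldType) (tf : {rmorphism S -> T}).
Hypothesis tf_inj : injective tf.
Local Notation L := (locpart tf).
Local Notation X := (frac_var tf).
Variables (f g : S) (d e : nat).
Hypotheses (f_homog : f \is d.-homog) (g_homog : g \is e.-homog).
Hypotheses (d_gt0 : (0 < d)%N) (e_gt0 : (0 < e)%N).
Hypothesis K_char0 : forall n, (0 < n)%N -> n%:R != 0 :> K.
Hypothesis fg_squarefree : squarefree_elt (f * g).
Hypothesis g_smooth : forall i, exists2 u,
  locvec tf [set i] (1 - e%:Z) u & dot u (grad tf g) = 1.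

Implicit Types (J : {set 'I_3}) (k l : int).
Local Notation F := (grad tf f).
Local Notation G := (grad tf g).
Local Notation H := (grad tf (f * g)).
Local Notation E := (euler_vec tf).
Local Notation N := (syz tf (f * g)).
Local Notation N' := (syz tf f).

Let tf0 : tf f != 0.
Proof.
rewrite (tf_eq0 tf_inj); apply: contraTneq (proj1 fg_squarefree) => ->.
by rewrite mul0r eqxx.
Qed.
Let tg0 : tf g != 0.
Proof.
rewrite (tf_eq0 tf_inj); apply: contraTneq (proj1 fg_squarefree) => ->.
by rewrite mulr0 eqxx.
Qed.
Let nat0 n : (0 < n)%N -> n%:R != 0 :> T.
Proof. by move=> n0; rewrite -(tf_nat tf) (tf_eq0 tf_inj) mpolyC_eq0 K_char0. Qed.
Let d0 : d%:R != 0 :> T. Proof. exact: nat0. Qed.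
Let e0 : e%:R != 0 :> T. Proof. exact: nat0. Qed.
Let de_gt0 : (0 < d + e)%N. Proof. by rewrite addn_gt0 d_gt0. Qed.
Let de0 : d%:R + e%:R != 0 :> T. Proof. by rewrite -natrD; exact: nat0. Qed.

Let EF : dot E F = d%:R * tf f. Proof. exact: dot_eul_grad. Qed.
Let EG : dot E G = e%:R * tf g. Proof. exact: dot_eul_grad. Qed.
Let HE : H = tf g *: F + tf f *: G. Proof. exact: gradM. Qed.
Let EH : dot E H = (d%:R + e%:R) * (tf f * tf g).
Proof. by rewrite HE dotDr !dotZr EF EG; ring. Qed.

Let lF J : locvec tf J (d%:Z - 1) F. Proof. exact: locvec_grad. Qed.
Let lG J : locvec tf J (e%:Z - 1) G. Proof. exact: locvec_grad. Qed.
Let lE J : locvec tf J 1 E. Proof. exact: locvec_eul. Qed.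
Let lf J : L J d%:Z (tf f). Proof. exact: locpart_homog. Qed.
Let lg J : L J e%:Z (tf g). Proof. exact: locpart_homog. Qed.
Let ld J : L J 0 (d%:R^-1). Proof. exact: (locpart_natV tf_inj J (K_char0 d_gt0)).
  Qed.
Let le J : L J 0 (e%:R^-1). Proof. exact: (locpart_natV tf_inj J (K_char0 e_gt0)).
  Qed.
Let lde J : L J 0 ((d%:R + e%:R)^-1).
Proof. by rewrite -natrD; exact: (locpart_natV tf_inj J (K_char0 de_gt0)). Qed.

(* The injection of [D_0(f)(-e)] into [D_0(fg)]: multiplication by [g],
   corrected by a multiple of the Euler derivation. *)
Definition lift_der (w : 'rV[T]_3) : 'rV[T]_3 :=
  tf g *: w - (dot w G / (d%:R + e%:R)) *: E.

(** The Euler coefficient is forced, so an element of the image of [lift_der] is recognized from any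
    decomposition g w + lam E. *)
Lemma lift_derE (lam : T) (dl w : 'rV[T]_3) :
    dot dl H = 0 -> dot w F = 0 -> dl = tf g *: w + lam *: E -> dl = lift_der w.
Proof.
move=> dlH wF dlE.
have key : tf f * tf g * (dot w G + lam * (d%:R + e%:R)) = 0.
  by rewrite -[RHS]dlH dlE dotDl !dotZl EH HE dotDr !dotZr wF; ring.
have lamE : lam = - (dot w G / (d%:R + e%:R)).
  move/eqP: key; rewrite mulf_eq0 mulf_eq0 (negPf tf0) (negPf tg0) /= addr_eq0 =>
    /eqP ->.
  by rewrite mulNr opprK mulfK.
by rewrite dlE /lift_der lamE scaleNr.
Qed.

Lemma lift_der_syz J k w : N' J k w -> N J (k + e%:Z) (lift_der w).
Proof.
move=> [hw wF]; split.
  apply: (locvecB tf_inj).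
    by rewrite addrC; exact: (locvecZ tf_inj (lg J) hw).
  rewrite (_ : k + e%:Z = (k + (e%:Z - 1) + 0) + 1); last by ring.
  apply: (locvecZ tf_inj _ (lE J)); apply: (locpartM tf_inj _ (lde J)).
  exact: (locvec_dot tf_inj hw (lG J)).
rewrite /lift_der dotBl !dotZl EH HE dotDr !dotZr wF.
by field.
Qed.

Lemma lift_derD u v : lift_der (u + v) = lift_der u + lift_der v.
Proof. by rewrite /lift_der dotDl mulrDl; apply/rowP => i; rewrite !mxE; ring. Qed.
Lemma lift_derZ a u : lift_der (a *: u) = a *: lift_der u.
Proof. by rewrite /lift_der dotZl -mulrA; apply/rowP => i; rewrite !mxE; ring. Qed.
Lemma lift_derN u : lift_der (- u) = - lift_der u.
Proof. by rewrite -scaleN1r lift_derZ scaleN1r. Qed.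

(** If g w is a multiple of E, pairing with grad f leaves that multiple times d f, which must
    vanish. *)
Lemma lift_der_inj w : dot w F = 0 -> lift_der w = 0 -> w = 0.
Proof.
move=> wF h.
have gw : tf g *: w = (dot w G / (d%:R + e%:R)) *: E.
  by apply/eqP; rewrite -subr_eq0; apply/eqP.
have : dot w G / (d%:R + e%:R) * (d%:R * tf f) = 0.
  by rewrite -EF -dotZl -gw dotZl wF mulr0.
move/eqP; rewrite !mulf_eq0 (negPf d0) (negPf tf0) !orbF => /orP.
move=> h0; have {}h0 : dot w G / (d%:R + e%:R) = 0 by apply/eqP; rewrite mulf_eq0;
  apply/orP.
move: gw; rewrite h0 scale0r => /eqP; rewrite scaler_eq0 (negPf tg0) => /eqP //.
Qed.

(* Sections that come from [D_0(f)(-e)] and from the Koszul derivations of [fg]. *)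
Definition liftable J k dl : Prop := exists rho w,
  [/\ locvec tf J (k - d%:Z - e%:Z + 1) rho, N' J (k - e%:Z) w &
      dl = cross H rho + lift_der w].

Lemma liftableD J k u v : liftable J k u -> liftable J k v -> liftable J k (u + v).
Proof.
move=> [r [w [hr hw ->]]] [r' [w' [hr' hw' ->]]]; exists (r + r'), (w + w').
split; [exact: (locvecD tf_inj)|exact: (syzD tf_inj)|].
by rewrite crossDr lift_derD addrACA.
Qed.

Lemma liftableZ J k l a u : L J l a -> liftable J k u -> liftable J (l + k) (a *: u).
Proof.
move=> ha [r [w [hr hw ->]]]; exists (a *: r), (a *: w); split.
- rewrite (_ : l + k - _ - _ + 1 = l + (k - d%:Z - e%:Z + 1)); last by ring.
  exact: (locvecZ tf_inj).
- by rewrite -addrA; exact: (syzZ tf_inj).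
- by rewrite crossZr lift_derZ scalerDr.
Qed.

Lemma liftableN J k u : liftable J k u -> liftable J k (- u).
Proof.
move=> [r [w [hr hw ->]]]; exists (- r), (- w).
split; [exact: locvecN|exact: syzN|].
by rewrite crossNr lift_derN opprD.
Qed.

Lemma liftable_sub J J' k u : J \subset J' -> liftable J k u -> liftable J' k u.
Proof.
move=> hJ [r [w [hr hw ->]]]; exists r, w.
by split; [exact: (locvec_sub tf_inj hJ)|exact: (syz_sub tf_inj hJ)|].
Qed.

Lemma liftable_syz J k u : liftable J k u -> N J k u.
Proof.
move=> [r [w [hr hw ->]]]; apply: (syzD tf_inj); last first.
  by rewrite -[k](addrNK e%:Z); exact: lift_der_syz.
split; last exact: dot_crossl.
rewrite (_ : k = (e%:Z + (d%:Z - 1)) + (k - d%:Z - e%:Z + 1)); last by ring.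
apply: (locvec_cross tf_inj _ hr); rewrite HE; apply: (locvecD tf_inj).
  exact: (locvecZ tf_inj).
by rewrite addrA (addrC e%:Z) -addrA; exact: (locvecZ tf_inj).
Qed.

Lemma liftable_clear J k j u : liftable (j |: J) k u ->
  exists m0, forall m, (m0 <= m)%N -> liftable J (k + m%:Z) (X j ^+ m *: u).
Proof.
move=> [r [w [hr [hw wF] ->]]].
have [m0 h0] := locvec_clear tf_inj hr; have [m1 h1] := locvec_clear tf_inj hw.
exists (maxn m0 m1) => m; rewrite geq_max => /andP[/h0 {}h0 /h1 {}h1].
exists (X j ^+ m *: r), (X j ^+ m *: w); split.
- by rewrite (_ : k + m%:Z - _ - _ + 1 = k - d%:Z - e%:Z + 1 + m%:Z); [|ring].
- by split; [rewrite addrAC|rewrite dotZl wF mulr0].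
- by rewrite crossZr lift_derZ scalerDr.
Qed.

(** Such a derivation is logarithmic along both curves: f dl(g) = - g dl(f), and [f], [g] is a
    regular sequence. *)
Lemma syz_log J i k dl : i \in J -> N J k dl ->
  exists r, [/\ L J (k - 1) r, dot dl G = tf g * r & dot dl F = - (tf f * r)].
Proof.
move=> iJ [hdl dlH].
have rel : tf f * dot dl G = tf g * - dot dl F.
  apply/eqP; rewrite -subr_eq0; apply/eqP; rewrite -[RHS]dlH HE dotDr !dotZr; ring.
have lFd := locpartN (locvec_dot tf_inj hdl (lF J)).
have lGd := locvec_dot tf_inj hdl (lG J).
have [|r hr dlG] := locpart_regular tf_inj f_homog g_homog fg_squarefree iJ lGd _ rel.
  by rewrite (_ : _ - e%:Z = k + (d%:Z - 1)); [|ring].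
exists r; split=> //; first by rewrite (_ : k - 1 = k + (e%:Z - 1) - e%:Z); [|ring].
by apply: (mulfI tg0); apply: oppr_inj; rewrite -mulrN -rel dlG; ring.
Qed.

(** Adding (r / d) E to [dl] makes it kill [f], and [lift_der] absorbs multiples of E; no Koszul
    term is needed. *)
Lemma liftable_mulg J i k dl : i \in J -> N J k dl ->
  liftable J (k + e%:Z) (tf g *: dl).
Proof.
move=> iJ hN; have [r [hr dlG dlF]] := syz_log iJ hN; have [hdl dlH] := hN.
pose w := dl + (r / d%:R) *: E.
have wF : dot w F = 0 by rewrite /w dotDl dotZl EF dlF; field.
have hw : N' J k w.
  split=> //; apply: (locvecD tf_inj hdl).
  rewrite (_ : k = (k - 1 + 0) + 1); last by ring.
  exact: (locvecZ tf_inj (locpartM tf_inj hr (ld J)) (lE J)).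
exists 0, w; split.
- by move=> a; rewrite mxE; apply: locpart0; apply/card_gt0P; exists i.
- by rewrite addrK.
- rewrite -[0](scale0r 0) crossZr scale0r add0r.
  apply: (@lift_derE (- (tf g * (r / d%:R)))) => //; first by rewrite dotZl dlH mulr0.
  by rewrite /w; apply/rowP => a; rewrite !mxE; ring.
Qed.

(** Subtracting (r / e) E makes [dl] kill [g]. As u . G = 1, a triple orthogonal to G is G x rho
    with rho = dl' x u. Since H = g F + f G, the Koszul term H x rho equals f dl' up to g F x rho,
    which [lift_der] accounts for. *)
Lemma liftable_mulf J i k dl : i \in J -> N J k dl ->
  liftable J (k + d%:Z) (tf f *: dl).
Proof.
move=> iJ hN; have [r [hr dlG dlF]] := syz_log iJ hN; have [hdl dlH] := hN.
have iJ' : [set i] \subset J by rewrite sub1set.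
have [u /(locvec_sub tf_inj iJ') hu uG] := g_smooth i.
pose dl' := dl - (r / e%:R) *: E.
have dl'G : dot dl' G = 0 by rewrite /dl' dotBl dotZl EG dlG; field.
have hdl' : locvec tf J k dl'.
  apply: (locvecB tf_inj hdl).
  rewrite (_ : k = (k - 1 + 0) + 1); last by ring.
  exact: (locvecZ tf_inj (locpartM tf_inj hr (le J)) (lE J)).
pose rho := cross dl' u.
have hrho : locvec tf J (k + (1 - e%:Z)) rho by exact: (locvec_cross tf_inj hdl' hu).
have Grho : cross G rho = dl'.
  by rewrite /rho crossCr (dotC G u) uG (dotC G) dl'G scale1r scale0r subr0.
have hw : N' J (k + d%:Z - e%:Z) (- cross F rho).
  apply: syzN; split; last exact: dot_crossl.
  rewrite (_ : _ - e%:Z = (d%:Z - 1) + (k + (1 - e%:Z))); last by ring.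
  exact: (locvec_cross tf_inj (lF J) hrho).
exists rho, (- cross F rho); split=> //.
  by rewrite (_ : _ + 1 = k + (1 - e%:Z)); [|ring].
apply/eqP; rewrite addrC -subr_eq; apply/eqP.
apply: (@lift_derE (tf f * (r / e%:R))).
- by rewrite dotBl dotZl dlH mulr0 dot_crossl subr0.
- by case: hw.
- rewrite HE crossDl !crossZl Grho /dl'.
  by apply/rowP => a; rewrite !mxE; ring.
Qed.

Lemma liftable_sep J i k x a b dl : i \in J -> L J (- d%:Z) a -> L J (- e%:Z) b ->
  1 - x = a * tf f + b * tf g -> N J k dl -> liftable J k (dl - x *: dl).
Proof.
move=> iJ ha hb xE hN.
rewrite -[X in X - _]scale1r -scalerBl xE scalerDl -!scalerA.
apply: liftableD.
  rewrite (_ : k = - d%:Z + (k + d%:Z)); last by ring.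
  exact: (liftableZ ha (liftable_mulf iJ hN)).
rewrite (_ : k = - e%:Z + (k + e%:Z)); last by ring.
exact: (liftableZ hb (liftable_mulg iJ hN)).
Qed.

(* The Koszul derivation of [rho] only depends, modulo [D_0(f)(-e)], on the
   restriction of [rho.E] to the curve [g = 0]. *)
Lemma koszul_lift J i k rho q : i \in J ->
    locvec tf J (k - d%:Z - e%:Z + 1) rho ->
    L J (k - d%:Z - e%:Z + 2 - e%:Z) q -> dot rho E = tf g * q ->
  exists2 w, N' J (k - e%:Z) w & cross H rho = lift_der w.
Proof.
move=> iJ hrho hq rhoE; have Xi := frac_var_neq0 tf_inj i.
(* As E . G = e g, [rho'] is orthogonal to E, hence of the form sig x E, and H x rho' = (H . E) sig
   - (H . sig) E, where g divides H . E. *)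
pose rho' := rho - (q / e%:R) *: G.
have rho'E : dot rho' E = 0 by rewrite /rho' dotBl dotZl (dotC G) EG rhoE; field.
have hqe : L J (k - d%:Z - e%:Z + 2 - e%:Z + 0) (q / e%:R) by exact: (locpartM tf_inj
  hq (le J)).
have hrho' : locvec tf J (k - d%:Z - e%:Z + 1) rho'.
  apply: (locvecB tf_inj hrho).
  rewrite (_ : _ + 1 = (k - d%:Z - e%:Z + 2 - e%:Z + 0) + (e%:Z - 1)); last by ring.
  exact: (locvecZ tf_inj hqe (lG J)).
pose kap : 'rV[T]_3 := (X i)^-1 *: delta_mx 0 i.
have hkap : locvec tf J (-1) kap.
  move=> a; rewrite !mxE eqxx /=; case: eqP => _.
    by rewrite mulr1; exact: (locpartXV tf_inj iJ).
  by rewrite mulr0; apply: locpart0; apply/card_gt0P; exists i.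
have kapE : dot kap E = 1.
  rewrite /kap dotZl /dot (bigD1 i) //= big1 ?addr0 => [|a ai].
    by rewrite !mxE !eqxx mul1r mulVf.
  by rewrite !mxE (negPf ai) andbF mul0r.
pose sig := cross kap rho'.
have hsig : locvec tf J (-1 + (k - d%:Z - e%:Z + 1)) sig.
  exact: (locvec_cross tf_inj hkap hrho').
have sigE : cross sig E = rho' by rewrite /sig crossCl kapE rho'E scale1r scale0r
  subr0.
(* The terms of H x rho with a factor g, divided by it (H x G is g F x G); the multiple of E makes
   the sum kill [f]. *)
pose w := ((d%:R + e%:R) * tf f) *: sig
  - ((d%:R + e%:R) * d%:R^-1 * dot sig F) *: E + (q / e%:R) *: cross F G.
have wF : dot w F = 0.
  by rewrite /w dotDl dotBl !dotZl EF dot_crossl; field; rewrite d0 e0.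
have lnat J' : L J' 0 (d%:R + e%:R) by rewrite -natrD -(tf_nat tf); exact: locpartC.
exists w.
  split=> //; apply: (locvecD tf_inj); [apply: (locvecB tf_inj)|].
  - rewrite (_ : k - e%:Z = (0 + d%:Z) + (-1 + (k - d%:Z - e%:Z + 1))); last by ring.
    exact: (locvecZ tf_inj (locpartM tf_inj (lnat J) (lf J)) hsig).
  - rewrite (_ : k - e%:Z = (0 + 0 + ((-1 + (k - d%:Z - e%:Z + 1)) + (d%:Z - 1))) +
      1); last by ring.
    apply: (locvecZ tf_inj _ (lE J)); apply: (locpartM tf_inj).
      exact: (locpartM tf_inj (lnat J) (ld J)).
    exact: (locvec_dot tf_inj hsig (lF J)).
  - rewrite (_ : k - e%:Z = (k - d%:Z - e%:Z + 2 - e%:Z + 0) + ((d%:Z - 1) + (e%:Z -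
      1))); last by ring.
    exact: (locvecZ tf_inj hqe (locvec_cross tf_inj (lF J) (lG J))).
apply: (@lift_derE (tf g * ((d%:R + e%:R) * d%:R^-1 * dot sig F) - dot H sig)) => //.
  exact: dot_crossl.
have -> : rho = cross sig E + (q / e%:R) *: G by rewrite sigE /rho' subrK.
rewrite crossDr crossZr crossCr (dotC H E) EH.
rewrite {2}HE crossDl !crossZl crossvv scaler0 addr0 /w.
by apply/rowP => a; rewrite !mxE; ring.
Qed.

(** Converse of [koszul_lift]. The cross product with E, then the dot product with [u], where u . G
    = 1, isolates f (rho . E) up to multiples of g; the regular sequence then removes the factor
    f. *)
Lemma koszul_cocycle J i k rho w : i \in J ->
    locvec tf J (k - d%:Z - e%:Z + 1) rho -> N' J (k - e%:Z) w ->
    cross H rho + lift_der w = 0 ->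
  exists2 q, L J (k - d%:Z - e%:Z + 2 - e%:Z) q & dot rho E = tf g * q.
Proof.
move=> iJ hrho [hw wF] h0.
have iJ' : [set i] \subset J by rewrite sub1set.
have [u /(locvec_sub tf_inj iJ') hu uG] := g_smooth i.
have hs : L J (k - d%:Z - e%:Z + 2) (dot rho E).
  rewrite (_ : _ + 2 = k - d%:Z - e%:Z + 1 + 1); last by ring.
  exact: (locvec_dot tf_inj hrho (lE J)).
pose v := (d%:R + e%:R) * (tf f * dot rho u) + dot (cross w E) u - dot rho E * dot F
  u.
have rel : tf f * dot rho E = tf g * v.
  have : dot (cross (cross H rho + lift_der w) E) u = 0.
    by rewrite h0 -(scale0r 0) crossZl dotZl mul0r.
  rewrite crossDl crossCl (dotC H E) EH /lift_der crossDl -!scaleNr !crossZl crossvv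
    scaler0 addr0.
  rewrite !dotDl !dotZl HE dotDl !dotZl (dotC G) uG => h.
  by apply/eqP; rewrite eq_sym -subr_eq0 /v; apply/eqP; rewrite -[RHS]h; ring.
apply: (locpart_regular tf_inj f_homog g_homog fg_squarefree iJ hs _ rel).
apply: (locpartB tf_inj); [apply: (locpartD tf_inj)|].
- rewrite (_ : _ - e%:Z = 0 + (d%:Z + ((k - d%:Z - e%:Z + 1) + (1 - e%:Z))));
    last by ring.
  apply: (locpartM tf_inj).
    by rewrite -natrD -(tf_nat tf); exact: locpartC.
  exact: (locpartM tf_inj (lf J) (locvec_dot tf_inj hrho hu)).
- rewrite (_ : _ - e%:Z = (k - e%:Z + 1) + (1 - e%:Z)); last by ring.
  exact: (locvec_dot tf_inj (locvec_cross tf_inj hw (lE J)) hu).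
- rewrite (_ : _ - e%:Z = (k - d%:Z - e%:Z + 2) + ((d%:Z - 1) + (1 - e%:Z)));
    last by ring.
  exact: (locpartM tf_inj hs (locvec_dot tf_inj (lF J) hu)).
Qed.

(** A right inverse of [rho -> dot rho E] where x_i is invertible. *)
Let at_var i (s : T) : 'rV[T]_3 := (s / X i) *: delta_mx 0 i.
Let at_varE i s : dot (at_var i s) E = s.
Proof.
rewrite /at_var dotZl /dot (bigD1 i) //= big1 ?addr0 => [|a ai].
  by rewrite !mxE !eqxx mul1r divfK // frac_var_neq0.
by rewrite !mxE (negPf ai) andbF mul0r.
Qed.
Let at_var_loc J i k s : i \in J -> L J (k + 1) s -> locvec tf J k (at_var i s).
Proof.
move=> iJ hs a; rewrite !mxE eqxx /=; case: eqP => _.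
  rewrite mulr1 -[k](addrK 1).
  exact: (locpartM tf_inj hs (locpartXV tf_inj iJ)).
by rewrite mulr0; apply: locpart0; apply/card_gt0P; exists i.
Qed.

Lemma syz_clear J k j w : N (j |: J) k w ->
  exists m0, forall m, (m0 <= m)%N -> N J (k + m%:Z) (X j ^+ m *: w).
Proof.
move=> [hw wH]; have [m0 h0] := locvec_clear tf_inj hw.
by exists m0 => m /h0 hm; split=> //; rewrite dotZl wH mulr0.
Qed.

(* The quotient by the liftable sections is supported at finitely many points. *)
Lemma extend_mod_liftable J i j k w : i != j -> i \in J -> N (j |: J) k w ->
  exists2 w', N J k w' & liftable (j |: J) k (w - w').
Proof.
move=> ij iJ hw; have [m /(_ _ (leqnn m)) hm] := syz_clear hw.
have [th [a [b [hth ha hb thE]]]] :=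
  separating_section tf_inj f_homog g_homog fg_squarefree m ij.
have iJ' : [set i] \subset J by rewrite sub1set.
have ijJ : [set i; j] \subset j |: J by rewrite setUC setUS.
exists (th *: (X j ^+ m *: w)).
  rewrite (_ : k = - m%:Z + (k + m%:Z)); last by ring.
  exact: (syzZ tf_inj (locpart_sub tf_inj iJ' hth) hm).
rewrite scalerA (mulrC th).
exact: (liftable_sep (setU11 j J) (locpart_sub tf_inj ijJ ha)
  (locpart_sub tf_inj ijJ hb) thE hw).
Qed.

(** Up to a section over D_+(x_0 x_2), [c] is liftable. Then rho . E has degree k - d - e + 2 >= -2,
    so it splits by H^2(O) = 0. Once its pieces are lifted by [at_var], the rest of rho is
    orthogonal to E and joins the part coming from D_0(f)(-e), split by hypothesis. *)
Lemma addition_H2 k : (d + e)%N%:Z - 4 <= k ->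
  vanishH2 (fun J => N' J (k - e%:Z)) -> vanishH2 (fun J => N J k).
Proof.
move=> hk h2 c hc.
have setTE : setT = 1 |: [set 0; 2] :> {set 'I_3}.
  by apply/setP => a; rewrite !inE; case: (ord3P a) => ->.
have [c02 hc02 [rho [w [hrho hw cE]]]] : exists2 c02, N [set 0;
  2] k c02 & liftable setT k (c - c02).
  rewrite setTE in hc *.
  exact: (extend_mod_liftable (isT : (0 : 'I_3) != 1) (set21 0 2) hc).
have hs : L setT (k - d%:Z - e%:Z + 2) (dot rho E).
  rewrite (_ : _ + 2 = k - d%:Z - e%:Z + 1 + 1); last by ring.
  exact: (locvec_dot tf_inj hrho (lE _)).
have k2 : -2 <= k - d%:Z - e%:Z + 2 by clear -hk; lia.
have [s01 [s02 [s12 [h01 h02 h12 sE]]]] := cechO_H2 tf_inj k2 hs.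
have [w01 [w02 [w12 [hw01 hw02 hw12 wE]]]] := h2 _ hw.
have loc (J : {set 'I_3}) i s : i \in J -> L J (k - d%:Z - e%:Z + 2) s ->
    locvec tf J (k - d%:Z - e%:Z + 1) (at_var i s).
  by move=> iJ hs'; apply: (at_var_loc iJ); rewrite -[_ + 1 + 1]addrA.
have sub J : J \subset [set: 'I_3] := subsetT J.
have r01 := loc [set 0; 1] 0 s01 (set21 _ _) h01.
have r02 := loc [set 0; 2] 0 s02 (set21 _ _) h02.
have r12 := loc [set 1; 2] 1 s12 (set21 _ _) h12.
set v01 := at_var 0 s01 in r01; set v02 := at_var 0 s02 in r02.
set v12 := at_var 1 s12 in r12.
have [w' hw' w'E] : exists2 w',
  N' setT (k - e%:Z) w' & cross H (rho - (v12 - v02 + v01)) = lift_der w'.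
  apply: (@koszul_lift _ 0 k _ 0); first by rewrite inE.
  - exact: (locvecB tf_inj hrho (locvecD tf_inj (locvecB tf_inj
      (locvec_sub tf_inj (sub _) r12) (locvec_sub tf_inj (sub _) r02))
      (locvec_sub tf_inj (sub _) r01))).
  - by apply: locpart0; rewrite cardsT card_ord.
  - by rewrite dotBl dotDl dotBl !at_varE sE subrr mulr0.
have [w'01 [w'02 [w'12 [hw'01 hw'02 hw'12 w'E2]]]] := h2 _ hw'.
have lft (J : {set 'I_3}) rr ww ww' : locvec tf J (k - d%:Z - e%:Z + 1) rr ->
    N' J (k - e%:Z) ww -> N' J (k - e%:Z) ww' ->
      N J k (cross H rr + lift_der (ww + ww')).
  move=> hr hww hww'; apply: liftable_syz; exists rr, (ww + ww'); split;
    [exact: hr|exact: (syzD tf_inj hww hww')|by []].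
exists (cross H v01 + lift_der (w01 + w'01)),
  (cross H v02 + lift_der (w02 + w'02) - c02),
  (cross H v12 + lift_der (w12 + w'12)).
split; [exact: (lft _ _ _ _ r01)|exact: (syzB tf_inj (lft _ _ _ _ r02 hw02 hw'02)
  hc02)|exact: (lft _ _ _ _ r12)|].
have -> : c = c02 + (cross H rho + lift_der w) by rewrite -cE addrC subrK.
have -> : cross H rho = lift_der w' + (cross H v12 - cross H v02 + cross H v01).
  by rewrite -w'E -crossNr -!crossDr subrK.
rewrite wE w'E2 !lift_derD !lift_derN.
by apply/rowP => a; rewrite !mxE; ring.
Qed.

(** This is the vanishing of H^1 for the quotient by liftable sections. [b1] and [b2] settle two of
    the overlaps; the defect on the third one is to be absorbed by a change of [b2] that is liftable
    over D_+(x_0 x_2). *)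
Lemma cocycle_mod_liftable k c01 c02 c12 :
    N [set 0; 1] k c01 -> N [set 0; 2] k c02 -> N [set 1; 2] k c12 ->
    c12 - c02 + c01 = 0 ->
  exists b0 b1 b2, [/\ N [set 0] k b0, N [set 1] k b1, N [set 2] k b2 &
    [/\ liftable [set 0; 1] k (c01 - (b1 - b0)),
        liftable [set 0; 2] k (c02 - (b2 - b0)) &
        liftable [set 1; 2] k (c12 - (b2 - b1))]].
Proof.
move=> h01 h02 h12 hc.
have [b1 hb1 lb1] : exists2 b1, N [set 1] k b1 & liftable [set 0; 1] k (c01 - b1).
  exact: (extend_mod_liftable (isT : (1 : 'I_3) != 0) (set11 1) h01).
have [b2 hb2 lb2] : exists2 b2, N [set 2] k b2 & liftable [set 0; 2] k (c02 - b2).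
  exact: (extend_mod_liftable (isT : (2 : 'I_3) != 0) (set11 2) h02).
pose c := c12 - b2 + b1.
have hcN : N [set 1; 2] k c.
  apply: (syzD tf_inj); [apply: (syzB tf_inj h12)|].
    by apply: (syz_sub tf_inj _ hb2); rewrite sub1set !inE.
  by apply: (syz_sub tf_inj _ hb1); rewrite sub1set !inE.
have lc : liftable (0 |: [set 1; 2]) k c.
  have -> : c = (c02 - b2) - (c01 - b1).
    have -> : c02 = c12 + c01 - (c12 - c02 + c01) by apply/rowP => a; rewrite !mxE;
      ring.
    by rewrite hc subr0 /c; apply/rowP => a; rewrite !mxE; ring.
  apply: liftableD; [|apply: liftableN].
    apply: (liftable_sub _ lb2); apply/subsetP => a; rewrite !inE.
    by case/orP=> ->; rewrite ?orbT.
  apply: (liftable_sub _ lb1); apply/subsetP => a; rewrite !inE.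
  by case/orP=> ->; rewrite ?orbT.
have [b2' hb2' lb2'] : exists2 b2', N [set 2] k b2' & liftable [set 1; 2] k (c - b2').
  exact: (extend_mod_liftable (isT : (2 : 'I_3) != 1) (set11 2) hcN).
have [m /(_ _ (leqnn m)) hm] := liftable_clear lc.
have hb2'm : liftable [set 1; 2] (k + m%:Z) (X 0 ^+ m *: b2').
  have -> : X 0 ^+ m *: b2' = X 0 ^+ m *: c - X 0 ^+ m *: (c - b2').
    by rewrite -scalerBr subKr.
  apply: (liftableD hm); apply: liftableN; rewrite addrC; apply: (liftableZ _ lb2').
  by rewrite -[m%:Z]mul1r; exact: (locpartXn tf_inj _ (locpartX tf _ _)).
have [th [a [b [hth ha hb thE]]]] :=
  separating_section tf_inj f_homog g_homog fg_squarefree m (isT : (2 : 'I_3) != 0).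
have s12 : ([set 2] : {set 'I_3}) \subset [set 1; 2] by rewrite sub1set !inE.
(* The factor 1 - x_0^m th makes [b2'] liftable over D_+(x_0 x_2). Over D_+(x_1 x_2) it is harmless:
   x_0^m b2' is liftable there, because [c] is liftable over D_+(x_0 x_1 x_2) and x_0^m clears its
   witnesses. *)
pose b2'' := b2' - (X 0 ^+ m * th) *: b2'.
have hX0 J : L J m%:Z (X 0 ^+ m).
  by rewrite -[m%:Z]mul1r; exact: (locpartXn tf_inj _ (locpartX tf _ _)).
have hb2'' : N [set 2] k b2''.
  apply: (syzB tf_inj hb2'); rewrite -[k](add0r k) -(subrr m%:Z).
  exact: (syzZ tf_inj (locpartM tf_inj (hX0 _) hth) hb2').
have lb2''2 : liftable [set 0; 2] k b2''.
  rewrite (setUC [set 0]).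
  exact: (liftable_sep (set21 2 0) ha hb thE (syz_sub tf_inj (subsetUl _ _) hb2')).
have lb2''1 : liftable [set 1; 2] k (c - b2'').
  have -> : c - b2'' = (c - b2') + th *: (X 0 ^+ m *: b2').
    by rewrite /b2'' scalerA (mulrC th) opprB addrA addrAC.
  apply: (liftableD lb2'); rewrite (_ : k = - m%:Z + (k + m%:Z)); last by ring.
  exact: (liftableZ (locpart_sub tf_inj s12 hth) hb2'm).
exists 0, b1, (b2 + b2''); split.
- split; last exact: dot0l.
  by move=> i; rewrite mxE; apply: locpart0; rewrite cards1.
- exact: hb1.
- exact: (syzD tf_inj hb2 hb2'').
split.
- by rewrite subr0.
- by rewrite subr0 opprD addrA; exact: (liftableD lb2 (liftableN lb2''2)).
- rewrite (_ : c12 - _ = c - b2'') //.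
  by rewrite /c; apply/rowP => i; rewrite !mxE; ring.
Qed.

Lemma addition_H1 k : (d + e)%N%:Z + e%:Z - 4 <= k ->
  vanishH1 (fun J => N' J (k - e%:Z)) -> vanishH1 (fun J => N J k).
Proof.
move=> hk h1 c01 c02 c12 h01 h02 h12 hc.
have [b0 [b1 [b2 [hb0 hb1 hb2 [l01 l02 l12]]]]]
  := cocycle_mod_liftable h01 h02 h12 hc.
have [r01 [w01 [hr01 hw01 E01]]] := l01; have [r02 [w02 [hr02 hw02 E02]]] := l02.
have [r12 [w12 [hr12 hw12 E12]]] := l12.
have sub J : J \subset [set: 'I_3] := subsetT J.
pose rho := r12 - r02 + r01; pose w := w12 - w02 + w01.
have hrho : locvec tf setT (k - d%:Z - e%:Z + 1) rho.
  exact: (locvecD tf_inj (locvecB tf_inj (locvec_sub tf_inj (sub _) hr12)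
    (locvec_sub tf_inj (sub _) hr02)) (locvec_sub tf_inj (sub _) hr01)).
have hw : N' setT (k - e%:Z) w.
  exact: (syzD tf_inj (syzB tf_inj (syz_sub tf_inj (sub _) hw12)
    (syz_sub tf_inj (sub _) hw02)) (syz_sub tf_inj (sub _) hw01)).
have rw0 : cross H rho + lift_der w = 0.
  rewrite /rho /w !crossDr !crossNr !lift_derD !lift_derN.
  transitivity ((cross H r12 + lift_der w12) - (cross H r02 + lift_der w02)
    + (cross H r01 + lift_der w01)).
    by apply/rowP => a; rewrite !mxE; ring.
  rewrite -E12 -E02 -E01 -[RHS]hc.
  by apply/rowP => a; rewrite !mxE; ring.
(* The functions r_ij . E form a cocycle only modulo g, with defect g q. The bound on [k] puts q in
   degree at least -2, so H^2(O) = 0 splits it; subtracting the pieces gives a true cocycle, to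
   which H^1(O) = 0 applies. This is H^1 of O_C read off O(-e) -> O -> O_C. *)
have [q hq rhoE] := koszul_cocycle (in_setT 0) hrho hw rw0.
have k2 : -2 <= k - d%:Z - e%:Z + 2 - e%:Z by clear -hk; lia.
have [q01 [q02 [q12 [hq01 hq02 hq12 qE]]]] := cechO_H2 tf_inj k2 hq.
pose kk := k - d%:Z - e%:Z + 2.
have hs J r qq : locvec tf J (k - d%:Z - e%:Z + 1) r -> L J (kk - e%:Z) qq ->
    L J kk (dot r E - tf g * qq).
  move=> hr hqq; apply: (locpartB tf_inj).
    rewrite (_ : kk = k - d%:Z - e%:Z + 1 + 1); last by rewrite /kk; ring.
    exact: (locvec_dot tf_inj hr (lE _)).
  rewrite (_ : kk = e%:Z + (kk - e%:Z)); last by ring.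
  exact: (locpartM tf_inj (lg J) hqq).
have scc : (dot r12 E - tf g * q12) - (dot r02 E - tf g * q02) + (dot r01 E - tf g *
  q01) = 0.
  move: rhoE; rewrite /rho dotDl dotBl qE => h.
  by apply/eqP; move/eqP: h; rewrite -subr_eq0 => /eqP h; apply/eqP; rewrite -[RHS]h;
    ring.
have [t0 [t1 [t2 [ht0 ht1 ht2 [e01 e02 e12]]]]] :=
  cechO_H1 tf_inj (hs _ _ _ hr01 hq01) (hs _ _ _ hr02 hq02) (hs _ _ _ hr12 hq12) scc.
have loc i s : L [set i] kk s -> locvec tf [set i] (k - d%:Z - e%:Z + 1) (at_var i s).
  move=> hs'; apply: (at_var_loc (set11 i)).
  by rewrite (_ : _ + 1 = kk); [exact: hs'|rewrite /kk; ring].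
have v0 := loc _ _ ht0; have v1 := loc _ _ ht1; have v2 := loc _ _ ht2.
have corr (i j : 'I_3) J r qq ti tj : [set i; j] = J ->
    locvec tf J (k - d%:Z - e%:Z + 1) r ->
    locvec tf [set i] (k - d%:Z - e%:Z + 1) (at_var i ti) ->
    locvec tf [set j] (k - d%:Z - e%:Z + 1) (at_var j tj) ->
    L J (kk - e%:Z) qq -> dot r E - tf g * qq = tj - ti ->
  exists2 w', N' J (k - e%:Z) w' & cross H (r - (at_var j tj - at_var i ti)) =
    lift_der w'.
  move=> <- hr hi hj hqq re; apply: (koszul_lift (set21 i j) _ hqq).
    apply: (locvecB tf_inj hr); apply: (locvecB tf_inj).
      by apply: (locvec_sub tf_inj _ hj); exact: subsetUr.
    by apply: (locvec_sub tf_inj _ hi); exact: subsetUl.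
  by rewrite !dotBl !at_varE -re opprB addrC subrK.
have [w'01 hw'01 E'01] := corr _ _ _ _ _ _ _ (erefl [set 0; 1]) hr01 v0 v1 hq01 e01.
have [w'02 hw'02 E'02] := corr _ _ _ _ _ _ _ (erefl [set 0; 2]) hr02 v0 v2 hq02 e02.
have [w'12 hw'12 E'12] := corr _ _ _ _ _ _ _ (erefl [set 1; 2]) hr12 v1 v2 hq12 e12.
have ha01 := syzD tf_inj hw01 hw'01; have ha02 := syzD tf_inj hw02 hw'02.
have ha12 := syzD tf_inj hw12 hw'12.
(* With the Koszul parts reduced to coboundaries, injectivity of [lift_der] transfers the cocycle
   relation to D_0(f)(-e). *)
have acc : (w12 + w'12) - (w02 + w'02) + (w01 + w'01) = 0.
  apply: lift_der_inj.
    by rewrite !(dotDl, dotNl) hw12.2 hw02.2 hw01.2 hw'12.2 hw'02.2 hw'01.2 !(addr0,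
      oppr0).
  rewrite !(lift_derD, lift_derN) -E'01 -E'02 -E'12 -[RHS]rw0 /rho /w.
  rewrite !(crossDr, crossNr) !(lift_derD, lift_derN).
  move: (cross H r12) (cross H r02) (cross H r01) (lift_der w12) (lift_der w02)
    (lift_der w01) (cross H (at_var 0 t0)) (cross H (at_var 1 t1))
    (cross H (at_var 2 t2)) => *.
  by apply/rowP => a; rewrite !mxE; ring.
have [a0 [a1 [a2 [ha0 ha1 ha2 [f01 f02 f12]]]]] := h1 _ _ _ ha01 ha02 ha12 acc.
have fin (J : {set 'I_3}) bb rr aa : N J k bb ->
  locvec tf J (k - d%:Z - e%:Z + 1) rr ->
    N' J (k - e%:Z) aa -> N J k (bb + (cross H rr + lift_der aa)).
  move=> hbb hrr haa; apply: (syzD tf_inj hbb); apply: liftable_syz.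
  by exists rr, aa; split; [exact: hrr|exact: haa|].
exists (b0 + (cross H (at_var 0 t0) + lift_der a0)),
  (b1 + (cross H (at_var 1 t1) + lift_der a1)),
    (b2 + (cross H (at_var 2 t2) + lift_der a2)).
split; [exact: (fin _ _ _ _ hb0 v0 ha0)|exact: (fin _ _ _ _ hb1 v1 ha1)|exact: (fin _
  _ _ _ hb2 v2 ha2)|].
have last_step c bi bj r ww w' ri rj ai aj
  : c - (bj - bi) = cross H r + lift_der ww ->
    cross H (r - (rj - ri)) = lift_der w' -> ww + w' = aj - ai ->
    c = bj + (cross H rj + lift_der aj) - (bi + (cross H ri + lift_der ai)).
  move=> Ec Er Ea.
  have -> : c = (bj - bi) + (cross H r + lift_der ww) by rewrite -Ec addrC subrK.
  have -> : lift_der aj = lift_der (ww + w') + lift_der ai by rewrite -lift_derD Ea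
    subrK.
  rewrite lift_derD -Er !(crossDr, crossNr).
  move: (cross H r) (cross H ri) (cross H rj) (lift_der ww) (lift_der ai) => *.
  by apply/rowP => a; rewrite !mxE; ring.
split.
- exact: last_step E01 E'01 f01.
- exact: last_step E02 E'02 f02.
- exact: last_step E12 E'12 f12.
Qed.
End Addition.

(** * The regularity bound *)

Section Smooth.
Variable K : closedFieldType.
Local Notation S := {mpoly K[3]}.
Variables (T : fieldType) (tf : {rmorphism S -> T}).
Hypothesis tf_inj : injective tf.
Variables (g : S) (e : nat).
Hypotheses (g_homog : g \is e.-homog) (e_gt0 : (0 < e)%N) (e_neq0 : e%:R != 0 :> K).
Hypothesis g_smooth : forall P : 'I_3 -> K, (exists i, P i != 0) -> g.@[P] = 0 ->
  exists i, (g^`M(i)).@[P] != 0.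

Lemma spec_dehom (i j : 'I_3) (y z : K) (v : S) :
  (specialize y (dehom i j v)).[z] =
  v.@[fun a => if a == i then 1 else if a == j then y else z].
Proof.
elim/mpolyind: v => [|c m p _ _ IH].
  by rewrite meval0 rmorph0 /specialize map_poly0 horner0.
rewrite mevalD mevalZ mevalX dehomD {1}/dehom mmapZ mmapX /mmap1.
have specD : {morph specialize y : U V / U + V} by exact: rmorphD.
rewrite specD specM hornerD hornerM IH /= specC !hornerC; congr (_ * _ + _).
rewrite (rmorph_prod (specialize y)) horner_prod; apply: eq_bigr => a _.
rewrite rmorphXn horner_exp /chart_var /=; congr (_ ^+ _).
case: eqP => _; first by rewrite rmorph1 hornerC.
case: eqP => _; first by rewrite specC hornerC hornerX.
by rewrite /specialize map_polyX hornerX.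
Qed.

(** By the Euler relation and e != 0, a common zero of the partial derivatives would lie on the
    curve, against smoothness. So on the chart they generate the unit ideal; division by x_i^(e-1)
    restores the degree. *)
Lemma smooth_unit (i : 'I_3) : exists2 u,
  locvec tf [set i] (1 - e%:Z) u & dot u (grad tf g) = 1.
Proof.
have [j [l [ij il jl]]] : exists j l : 'I_3, [/\ i != j, i != l & j != l].
  by case: (ord3P i) => ->; [exists 1, 2|exists 0, 2|exists 0, 1].
have Xi := frac_var_neq0 tf_inj i.
have [y z|A hA] := @nullstellensatz2 _ (fun a => dehom i j (g^`M(a))).
  pose P (a : 'I_3) := if a == i then 1 else if a == j then y else z.
  have [/existsP[a ha]|/existsPn h] := boolP [exists a, (g^`M(a)).@[P] != 0].
    by exists a; rewrite spec_dehom.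
  have gP : g.@[P] = 0.
    apply: (mulfI e_neq0); rewrite mulr0 -mevalZ -(euler g_homog) rmorph_sum.
    by apply: big1 => a _; rewrite /= mevalM (eqP (negPn (h a))) mulr0.
  have [|a] := g_smooth _ gP; last by move/negPn: (h a) => /eqP ->; rewrite eqxx.
  by exists i; rewrite /P eqxx oner_neq0.
have [e' eE] : exists e', e = e'.+1 by exists e.-1; rewrite prednK.
have ghom a : g^`M(a) \is e'.-homog by apply: mderiv_homog; rewrite -eE.
exists (\row_a (chart_val tf i j l (A a) * frac_var tf i ^- e')).
  move=> a; rewrite mxE eE (_ : 1 - _ = 0 + - 1 * e'%:Z); last by rewrite intS; ring.
  apply: (locpartM tf_inj (locpart_chart_val tf_inj ij il jl _)); rewrite -exprVn.
  by apply: (locpartXn tf_inj); apply: (locpartXV tf_inj); rewrite set11.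
have := congr1 (chart_val tf i j l) hA; rewrite rmorph1 rmorph_sum => <-.
apply: eq_bigr => a _; rewrite !mxE rmorphM /= (chart_val_dehom tf_inj ij il jl (ghom
  a)).
by ring.
Qed.
End Smooth.

(** * Comparison with the Cech cochains of the statement *)

Section CechTriples.
Variable R : realType.
Local Notation S := (polyS R).
Local Notation tf := (@tofrac S).

Lemma tofrac_inj : injective tf.
Proof. by move=> a b /eqP; rewrite tofrac_eq => /eqP. Qed.

(** [loc] asks for one denominator and a numerator in [D0 h], [syz] for separate denominators and a
    relation between fractions. Raising exponents makes the denominators equal, and the relation
    descends to numerators by injectivity of [tofrac]. *)
Lemma loc_D0 (h : S) (J : {set 'I_3}) k w : loc (D0 h) J k w <-> syz tf h J k w.
Proof.
split.
  move=> [m [e [v [hv he eE ->]]]]; split.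
    by move=> i; exists m, e, (v 0 i); split=> //; rewrite !mxE.
  rewrite /dot (eq_bigr (fun i => (tofrac (monJ R J ^+ m))^-1 * tofrac (v 0 i *
    h^`M(i)))).
    have hv' : \sum_(i < 3) v 0 i * h^`M(i) = 0 by exact: hv.
    by rewrite -mulr_sumr -(rmorph_sum tf) hv' rmorph0 mulr0.
  by move=> i _; rewrite !mxE tofracM mulrA.
move=> [hw wh].
have [m0 h0] := locpart_raise tofrac_inj (hw 0).
have [m1 h1] := locpart_raise tofrac_inj (hw 1).
have [m2 h2] := locpart_raise tofrac_inj (hw 2).
pose m := maxn m0 (maxn m1 m2).
have [|e0 [v0 [hv0 eE0 w0]]] := h0 m; first by rewrite leq_max leqnn.
have [|e1 [v1 [hv1 eE1 w1]]] := h1 m; first by rewrite !leq_max leqnn orbT.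
have [|e2 [v2 [hv2 eE2 w2]]] := h2 m; first by rewrite !leq_max leqnn !orbT.
have e10 : e1 = e0 by apply/eqP; rewrite -eqz_nat eE1 eE0.
have e20 : e2 = e0 by apply/eqP; rewrite -eqz_nat eE2 eE0.
rewrite e10 in hv1; rewrite e20 in hv2.
pose v : 'rV[S]_3 := \row_i (if i == 0 then v0 else if i == 1 then v1 else v2).
have wE : w = (tofrac (monJ R J ^+ m))^-1 *: map_mx tf v.
  by apply/rowP => i; rewrite !mxE; case: (ord3P i) => ->.
exists m, e0, v; split=> //; last first.
  by move=> i; rewrite mxE; case: (ord3P i) => ->.
apply: tofrac_inj; apply: (mulfI (invr_neq0 (tf_mon_neq0 tofrac_inj J m))).
rewrite rmorph0 mulr0 -[RHS]wh wE dotZl rmorph_sum; congr (_ * _).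
by apply: eq_bigr => i _; rewrite rmorphM !mxE.
Qed.

Lemma setD1_0 : setT :\ 0 = [set 1; 2] :> {set 'I_3}.
Proof. by apply/setP => a; rewrite !inE; case: (ord3P a) => ->. Qed.
Lemma setD1_1 : setT :\ 1 = [set 0; 2] :> {set 'I_3}.
Proof. by apply/setP => a; rewrite !inE; case: (ord3P a) => ->. Qed.
Lemma setD1_2 : setT :\ 2 = [set 0; 1] :> {set 'I_3}.
Proof. by apply/setP => a; rewrite !inE; case: (ord3P a) => ->. Qed.

Lemma card2P (J : {set 'I_3}) : #|J| = 2%N ->
  [\/ J = [set 0; 1], J = [set 0; 2] | J = [set 1; 2]].
Proof.
move=> hJ; have /eqP/cards1P[a aE] : #|~: J| = 1%N.
  by have := cardsC J; rewrite hJ card_ord; lia.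
have -> : J = setT :\ a by rewrite -[J]setCK aE setTD.
case: (ord3P a) => ->; rewrite ?setD1_0 ?setD1_1 ?setD1_2.
- exact: Or33.
- exact: Or32.
- exact: Or31.
Qed.

Lemma card3P (J : {set 'I_3}) : #|J| = 3 -> J = setT.
Proof. by move=> hJ; apply/eqP; rewrite eqEcard subsetT cardsT card_ord hJ. Qed.

Local Notation V := 'rV[{fraction S}]_3.

Lemma cech_diffT (c : {set 'I_3} -> V) :
  cech_diff c setT = c [set 1; 2] - c [set 0; 2] + c [set 0; 1].
Proof.
rewrite /cech_diff (eq_bigl xpredT) => [|i]; last by rewrite inE.
rewrite sum3E setD1_0 setD1_1 setD1_2.
have -> : [set i in [set: 'I_3] | (i < (0%R : 'I_3))%N] = finset.set0.
  by apply/setP => a; rewrite !inE.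
have -> : [set i in [set: 'I_3] | (i < (1%R : 'I_3))%N] = [set 0].
  by apply/setP => a; rewrite !inE; case: (ord3P a) => ->.
have -> : [set i in [set: 'I_3] | (i < (2%R : 'I_3))%N] = [set 0; 1].
  by apply/setP => a; rewrite !inE; case: (ord3P a) => ->.
by rewrite cards0 cards1 cards2 expr0 expr1 scale1r scaleN1r sqrrN expr1n scale1r.
Qed.

Lemma cech_diff2 (b : {set 'I_3} -> V) (i j : 'I_3) : (i < j)%N ->
  cech_diff b [set i; j] = b [set j] - b [set i].
Proof.
move=> ij; have nij : i != j by apply: contraTneq ij => ->; rewrite ltnn.
rewrite /cech_diff big_setU1 ?inE //= big_set1.
have -> : [set a in [set i; j] | (a < i)%N] = finset.set0.
  apply/setP => a; rewrite !inE; apply/negP => /andP[/orP[] /eqP ->].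
    by rewrite ltnn.
  by rewrite ltnNge ltnW.
have -> : [set a in [set i; j] | (a < j)%N] = [set i].
  apply/setP => a; rewrite !inE; have [->|_] := eqVneq a i; first by rewrite ij.
  by have [->|] := eqVneq a j; rewrite ?ltnn.
rewrite cards0 cards1 expr0 expr1 scale1r scaleN1r.
have -> : [set i; j] :\ i = [set j].
  by apply/setP => a; rewrite !inE; have [->|] := eqVneq a i; rewrite // (negPf nij).
have -> // : [set i; j] :\ j = [set i].
by apply/setP => a; rewrite !inE; have [->|] := eqVneq a j;
  rewrite ?orbF //= eq_sym (negPf nij).
Qed.

Lemma cech_acyclic_H1 (h : S) k :
  cech_acyclic (D0 h) k 0 <-> vanishH1 (fun J => syz tf h J k).
Proof.
split.
  move=> hc c01 c02 c12 h01 h02 h12 c0.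
  pose c (J : {set 'I_3}) : V := if J == [set 0; 1] then c01
    else if J == [set 0; 2] then c02 else c12.
  have n0 : [set 0; 2] == [set 0; 1] :> {set 'I_3} = false.
    by apply/eqP => /setP/(_ 2); rewrite !inE.
  have n1 : [set 1; 2] == [set 0; 1] :> {set 'I_3} = false.
    by apply/eqP => /setP/(_ 2); rewrite !inE.
  have n2 : [set 1; 2] == [set 0; 2] :> {set 'I_3} = false.
    by apply/eqP => /setP/(_ 1); rewrite !inE.
  have c01E : c [set 0; 1] = c01 by rewrite /c eqxx.
  have c02E : c [set 0; 2] = c02 by rewrite /c n0 eqxx.
  have c12E : c [set 1; 2] = c12 by rewrite /c n1 n2.
  have [| |b hb bE] := hc c.
  - by move=> J /card2P[] ->; rewrite ?c01E ?c02E ?c12E; apply/loc_D0.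
  - by move=> J /card3P ->; rewrite cech_diffT c01E c02E c12E.
  exists (b [set 0]), (b [set 1]), (b [set 2]).
  split; [apply/loc_D0/hb; exact: cards1|apply/loc_D0/hb;
    exact: cards1|apply/loc_D0/hb; exact: cards1|].
  by rewrite -c01E -c02E -c12E !bE ?cards2 // !cech_diff2.
move=> hv c hc c0.
have [] := hv (c [set 0; 1]) (c [set 0; 2]) (c [set 1; 2]).
- by apply/loc_D0/hc; rewrite cards2.
- by apply/loc_D0/hc; rewrite cards2.
- by apply/loc_D0/hc; rewrite cards2.
- by rewrite -cech_diffT c0 // cardsT card_ord.
move=> b0 [b1 [b2 [hb0 hb1 hb2 [e01 e02 e12]]]].
pose b (J : {set 'I_3}) : V := if 0 \in J then b0 else if 1 \in J then b1 else b2.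
exists b.
  move=> J /eqP/cards1P[a ->]; apply/loc_D0; rewrite /b !inE.
  by case: (ord3P a) => ->.
by move=> J /card2P[] ->; rewrite cech_diff2 // /b !inE.
Qed.

Lemma cech_acyclic_H2 (h : S) k :
  cech_acyclic (D0 h) k 1 <-> vanishH2 (fun J => syz tf h J k).
Proof.
split.
  move=> hc c hcT; have [| |b hb bE] := hc (fun=> c).
  - by move=> J /card3P ->; apply/loc_D0.
  (* The cocycle condition concerns subsets with 4 elements, and there are none. *)
  - by move=> J hJ; have := max_card (mem J); rewrite hJ card_ord.
  exists (b [set 0; 1]), (b [set 0; 2]), (b [set 1; 2]).
  split; [apply/loc_D0/hb; exact: cards2|apply/loc_D0/hb;
    exact: cards2|apply/loc_D0/hb; exact: cards2|].
  by rewrite -cech_diffT -bE // cardsT card_ord.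
move=> hv c hc _.
have [|b01 [b02 [b12 [h01 h02 h12 cE]]]] := hv (c setT).
  by apply/loc_D0/hc; rewrite cardsT card_ord.
pose b (J : {set 'I_3}) : V
  := if 2 \notin J then b01 else if 1 \notin J then b02 else b12.
exists b.
  by move=> J /card2P[] ->; apply/loc_D0; rewrite /b !inE.
by move=> J /card3P ->; rewrite cech_diffT cE /b !inE.
Qed.
End CechTriples.

(** * Proof of the bound *)

Lemma unit_mpolyC (K : fieldType) n (c : K) : c != 0 -> (c%:MP
  : {mpoly K[n]}) \is a GRing.unit.
Proof. by move=> c0; apply: rmorph_unit; rewrite unitfE. Qed.

Lemma tdegree_homog (R : realType) (p : polyS R) (d : nat) :
  p != 0 -> p \is d.-homog -> tdegree p = d.
Proof. by move=> p0 hp; apply: (dhomog_uniq p0 _ hp); exact: dhomog_msize hp. Qed.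

Lemma regular_addition (R : realType) (f g : polyS R) (d e : nat) (m : int) :
    f \is d.-homog -> g \is e.-homog -> (0 < d)%N -> (0 < e)%N ->
    squarefree_elt (f * g) -> smooth_curve g -> regular (D0 f) m ->
  regular (D0 (f * g)) (Num.max (m + e%:Z) (d%:Z + 2 * e%:Z - 3)).
Proof.
move=> hf hg d0 e0 sq sm [/cech_acyclic_H1 h1 /cech_acyclic_H2 h2].
set M := Num.max _ _.
have M1 : m + e%:Z <= M by rewrite le_max lexx.
have M2 : d%:Z + 2 * e%:Z - 3 <= M by rewrite le_max lexx orbT.
have c0 n : (0 < n)%N -> n%:R != 0 :> R[i] by rewrite pnatr_eq0 -lt0n.
have tfi := @tofrac_inj R.
have un i := smooth_unit tfi hg e0 (c0 _ e0) sm i.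
have h2' : vanishH2 (fun J => syz (@tofrac (polyS R)) f J (m - 1 - 1)).
  by rewrite (_ : m - 1 - 1 = m - 2); [|ring].
have mM : m - 1 <= M - 1 - e%:Z by rewrite lerBrDr; lia.
have [k1 k2] := vanish_up tfi mM h1 h2'.
split.
  apply/cech_acyclic_H1; apply: (addition_H1 tfi hf hg d0 e0 c0 sq un _ k1).
  (* At k = M - 1 the bound of [addition_H1] is exactly M >= d + 2e - 3. *)
  by move: M2; clear; lia.
apply/cech_acyclic_H2; apply: (addition_H2 tfi hf hg d0 e0 c0 sq un).
  (* At k = M - 2 only M >= d + e - 2 is required, which follows as e >= 1. *)
  by move: M2 e0; clear; lia.
by rewrite (_ : M - 2 - e%:Z = M - 1 - e%:Z - 1); [|ring].
Qed.

(* The number of components is s = n + 1; C_s is given by F ord_max. *)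
Theorem corollary1p3 (R : realType) (d : nat) (f : polyS R) (n : nat)
    (F : 'I_n.+1 -> polyS R) (f' : polyS R) (ds : nat)
    (hd : (3 <= d)%N)
    (f_homog : f \is d.-homog)
    (f_reduced : squarefree_elt f)
    (f_fact : f = \prod_(i < n.+1) F i)
    (F_irr : forall i, irreducible_elt (F i))
    (s_gt1 : (1 < n.+1)%N)
    (Cs_smooth : smooth_curve (F ord_max))
    (Cs_deg : tdegree (F ord_max) = ds)
    (f'_def : f' = \prod_(i < n) F (widen_ord (leqnSn n) i)) :
  (reg (D0 f) <=
     maxe (reg (D0 f') + (ds%:R)%:E)
          (((tdegree f')%:R + 2 * ds%:R - 3)%:E))%E.
Proof.
have fE : f = f' * F ord_max by rewrite f_fact f'_def big_ord_recr.
move: f_homog f_reduced; rewrite fE => fg_homog sq.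
have fg0 := sq.1; move: (fg0); rewrite mulf_eq0 negb_or => /andP[f0 g0].
have [a ha] := homog_factor fg0 fg_homog.
have [b hb] : exists b, F ord_max \is b.-homog.
  by move: fg0 fg_homog; rewrite mulrC => fg0 fg_homog; exact: homog_factor fg0 fg_homog.
have nonunit0 (p : polyS R) : p != 0 -> p \is 0.-homog -> p \is a GRing.unit.
  move=> p0 /homog0E pE; rewrite pE; apply: unit_mpolyC.
  by apply: contraNneq p0 => c0; rewrite pE c0 mpolyC0.
(* As s > 1, [f'] has at least one irreducible factor, so it is not constant. *)
have a0 : (0 < a)%N.
  rewrite lt0n; apply/eqP => a0; rewrite a0 in ha.
  have := nonunit0 _ f0 ha; rewrite f'_def.
  have n0 : (0 < n)%N by rewrite -ltnS.
  rewrite (bigD1 (Ordinal n0)) //= unitrM => /andP[u _].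
  by have [_ /negP[]] := F_irr (widen_ord (leqnSn n) (Ordinal n0)).
have b0 : (0 < b)%N.
  rewrite lt0n; apply/eqP => b0; rewrite b0 in hb.
  by have [_ /negP[]] := F_irr ord_max; exact: nonunit0.
rewrite (tdegree_homog f0 ha); move: Cs_deg; rewrite (tdegree_homog g0 hb) => <-.
(* By contradiction, since [reg (D0 f')] may be infinite: the strict inequality yields an actual [m]
   at which [D0 f'] is regular. *)
rewrite leNgt; apply/negP; rewrite gt_max => /andP[].
rewrite -lteBrDr // => /ereal_inf_lt[_ [m hm <-]]; rewrite lteBrDr // => lt1 lt2.
have := regular_addition ha hb a0 b0 sq Cs_smooth hm; set M := Num.max _ _ => hM.
have : (reg (D0 (f' * F ord_max)) <= (M%:~R)%:E)%E by apply: ereal_inf_lbound; exists M.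
apply/negP; rewrite -ltNge /M maxEle; case: ifP => _.
  by move: lt2; rewrite intrB intrD intrM -!pmulrn.
by move: lt1; rewrite -EFinD intrD -pmulrn.
Qed.
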